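(* In a sharp theory with purification, for every system $\mathrm{A}$ there exists a bijection $\dagger$ from the set of normalized pure states of $\mathrm{A}$ to the set of normalized pure effects of $\mathrm{A}$ such that $(\alpha^\dagger|\alpha)=1$ for every normalized pure state $\alpha$ of $\mathrm{A}$.
   Context: Setting: an operational-probabilistic theory (general probabilistic theory in the circuit framework). It has systems with a symmetric associative composition $\otimes$ and a trivial system $\mathrm{I}$ ($\mathrm{I}\otimes\mathrm{A}=\mathrm{A}$). Transformations between systems are closed under sequential and parallel composition. States of $\mathrm{A}$ are transformations $\mathrm{I}\to\mathrm{A}$, effects are transformations $\mathrm{A}\to\mathrm{I}$, and a state $\rho$ followed by an effect $a$ gives a probability $(a|\rho)\in[0,1]$. Tests are theory-specified collections of transformations representing alternative outcomes of one experiment (observation-tests: tests made of effects); single-outcome tests are channels. States and effects span finite-dimensional real vector spaces; all sets of transformations are convex and compact. A transformation $\mathcal C$ is pure if whenever $\mathcal C=\sum_j\mathcal D_j$ with $\{\mathcal D_j\}$ outcomes of a test, each $\mathcal D_j=p_j\mathcal C$, $p_j\ge0$. A channel is reversible if it has an inverse channel. Every test can be realized as a channel followed by an observation-test on an auxiliary output. A sharp theory with purification satisfies: (Causality) every system has a unique deterministic effect $u_\mathrm{A}$, observation-tests sum to $u_\mathrm{A}$, marginals are $\mathrm{Tr}_\mathrm{B}\rho_{\mathrm{AB}}:=(\mathcal I_\mathrm{A}\otimes u_\mathrm{B})\rho_{\mathrm{AB}}$, and $\rho$ is normalized if $(u_\mathrm{A}|\rho)=1$; an effect $a$ is normalized if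 $\sup_\rho(a|\rho)=1$ over normalized states; (Purity Preservation) sequential and parallel compositions of pure transformations are pure; (Pure Sharpness) every system has a pure effect $a$ with $(a|\rho)=1$ for some state $\rho$; (Purification) every normalized state $\rho$ of $\mathrm{A}$ has a purification, a pure normalized state $\Psi$ of some $\mathrm{A}\otimes\mathrm{B}$ with $\mathrm{Tr}_\mathrm{B}\Psi=\rho$, and two purifications with the same purifying system $\mathrm{B}$ differ by a reversible channel on $\mathrm{B}$. *)

(* Defs.v *)
From HB Require Import structures.
From mathcomp Require Import all_boot all_order all_algebra.
From mathcomp Require Import all_classical all_reals all_analysis.

Set Implicit Arguments.
Unset Strict Implicit.
Unset Printing Implicit Defensive.

Import Order.TTheory GRing.Theory Num.Theory.
Import numFieldNormedType.Exports.
Local Open Scope ring_scope.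

(*  - V A B : the (finite-dimensional) real vector space spanned by the      *)
(*    transformations A -> B; Tr A B : the transformations inside it.        *)
(*  - scal : identification of V I I with the reals (probabilities).         *)
(*  - I (x) A = A, A (x) I = A and associativity hold on the nose; symmetry  *)
(*    is given by swap channels.                                             *)
Record OPTData (R : realType) := {
  Sys : Type;
  Iu : Sys;
  tens : Sys -> Sys -> Sys;
  V : Sys -> Sys -> vectType R;
  Tr : forall A B : Sys, V A B -> Prop;
  Test : forall A B : Sys, seq (V A B) -> Prop;
  comp : forall A B C : Sys, V B C -> V A B -> V A C;
  par : forall A B C D : Sys, V A B -> V C D -> V (tens A C) (tens B D);
  idt : forall A : Sys, V A A;
  swap : forall A B : Sys, V (tens A B) (tens B A);
  scal : V Iu Iu -> R;
  tensI_l : forall A, tens Iu A = A;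
  tensI_r : forall A, tens A Iu = A;
  tensA : forall A B C, tens A (tens B C) = tens (tens A B) C
}.

Arguments Iu {R} _.
Arguments tens {R} _ _ _.
Arguments V {R} _ _ _.
Arguments Tr {R _ A B} _.
Arguments Test {R _ A B} _.
Arguments comp {R _ A B C} _ _.
Arguments par {R _ A B C D} _ _.
Arguments idt {R} _ A.
Arguments swap {R} _ A B.
Arguments scal {R _} _.
Arguments tensI_l {R} _ A.
Arguments tensI_r {R} _ A.
Arguments tensA {R} _ A B C.

Section OPTDefs.
Variables (R : realType) (T : OPTData R).
Local Notation Sys := (Sys T).
Local Notation I := (Iu T).
Local Notation "A ⊗ B" := (tens T A B) (at level 40, left associativity).
Local Notation V := (V T).

Definition castV (A A' B B' : Sys) (eA : A = A') (eB : B = B') (f : V A B)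
  : V A' B' :=
  match eA in _ = X, eB in _ = Y return V X Y with erefl, erefl => f end.

Definition prb (A : Sys) (a : V A I) (rho : V I A) : R := scal (comp a rho).

Definition channel (A B : Sys) (C : V A B) : Prop := Test [:: C].

Definition reversible (A B : Sys) (U : V A B) : Prop :=
  channel U /\ exists W : V B A,
    channel W /\ comp W U = idt T A /\ comp U W = idt T B.

Definition pure (A B : Sys) (C : V A B) : Prop :=
  Tr C /\
  forall (s : seq (V A B)) (m : bitseq), Test s ->
    C = \sum_(D <- mask m s) D ->
    forall D, D \in mask m s -> exists p : R, 0 <= p /\ D = p *: C.

Definition det_effect (A : Sys) (u : V A I) : Prop := Test [:: u].

(* normalized state: (u_A|rho) = 1 (u_A is unique under Causality) *)
Definition norm_state (A : Sys) (rho : V I A) : Prop :=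
  Tr rho /\ forall u : V A I, det_effect u -> prb u rho = 1.

Definition norm_effect (A : Sys) (a : V A I) : Prop :=
  Tr a /\
  (forall rho : V I A, norm_state rho -> prb a rho <= 1) /\
  (forall eps : R, 0 < eps ->
     exists rho : V I A, norm_state rho /\ 1 - eps < prb a rho).

Definition marg (A B : Sys) (u : V B I) (Psi : V I (A ⊗ B)) : V I A :=
  castV erefl (tensI_r T A) (comp (par (idt T A) u) Psi).

Definition purification (A B : Sys) (rho : V I A) (Psi : V I (A ⊗ B)) : Prop :=
  pure Psi /\ norm_state Psi /\
  forall u : V B I, det_effect u -> marg u Psi = rho.

(* coordinates in a fixed basis, used to speak of compactness *)
Definition coords (W : vectType R) (v : W) : 'rV[R]_(\dim (fullv : {vspace W})) :=
  \row_i coord (vbasis fullv) i v.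

Record OPT_axioms : Prop := {
  comp_assoc : forall (A B C D : Sys) (h : V C D) (g : V B C) (f : V A B),
      comp h (comp g f) = comp (comp h g) f;
  comp_id_l : forall (A B : Sys) (f : V A B), comp (idt T B) f = f;
  comp_id_r : forall (A B : Sys) (f : V A B), comp f (idt T A) = f;
  comp_linear_l : forall (A B C : Sys) (a : R) (g g' : V B C) (f : V A B),
      comp (a *: g + g') f = a *: comp g f + comp g' f;
  comp_linear_r : forall (A B C : Sys) (a : R) (g : V B C) (f f' : V A B),
      comp g (a *: f + f') = a *: comp g f + comp g f';
  par_linear_l : forall (A B C D : Sys) (a : R) (f f' : V A B) (g : V C D),
      par (a *: f + f') g = a *: par f g + par f' g;
  par_linear_r : forall (A B C D : Sys) (a : R) (f : V A B) (g g' : V C D),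
      par f (a *: g + g') = a *: par f g + par f g';
  par_comp : forall (A B C A' B' C' : Sys) (g : V B C) (f : V A B)
      (g' : V B' C') (f' : V A' B'),
      par (comp g f) (comp g' f') = comp (par g g') (par f f');
  par_id : forall A B : Sys, par (idt T A) (idt T B) = idt T (A ⊗ B);
  par_assoc : forall (A B C A' B' C' : Sys) (f : V A A') (g : V B B') (h : V C C'),
      castV (tensA T A B C) (tensA T A' B' C') (par f (par g h))
      = par (par f g) h;
  par_I_l : forall (A B : Sys) (p : V I I) (f : V A B),
      castV (tensI_l T A) (tensI_l T B) (par p f) = scal p *: f;
  par_I_r : forall (A B : Sys) (p : V I I) (f : V A B),
      castV (tensI_r T A) (tensI_r T B) (par f p) = scal p *: f;
  swap_rev : forall A B : Sys, reversible (swap T A B);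
  swap_inv : forall A B : Sys, comp (swap T B A) (swap T A B) = idt T (A ⊗ B);
  swap_nat : forall (A B C D : Sys) (f : V A B) (g : V C D),
      comp (swap T B D) (par f g) = comp (par g f) (swap T A C);
  scal_linear : forall (a : R) (p q : V I I), scal (a *: p + q) = a * scal p + scal q;
  scal_inj : forall p q : V I I, scal p = scal q -> p = q;
  scal_id : scal (idt T I) = 1;
  scal_comp : forall p q : V I I, scal (comp p q) = scal p * scal q;
  scal_prob : forall p : V I I, Tr p -> 0 <= scal p <= 1;
  Tr_test : forall (A B : Sys) (f : V A B), Tr f <-> exists s, Test s /\ f \in s;
  test_id : forall A : Sys, channel (idt T A);
  test_seq : forall (A B C : Sys) (s : seq (V A B)) (t : seq (V B C)),
      Test s -> Test t -> Test [seq comp d c | c <- s, d <- t];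
  test_par : forall (A B C D : Sys) (s : seq (V A B)) (t : seq (V C D)),
      Test s -> Test t -> Test [seq par c d | c <- s, d <- t];
  test_perm : forall (A B : Sys) (s t : seq (V A B)),
      Test s -> perm_eq s t -> Test t;
  test_coarse : forall (A B : Sys) (s t : seq (V A B)),
      Test (s ++ t) -> Test ((\sum_(x <- s) x) :: t);
  test_realize : forall (A B : Sys) (s : seq (V A B)), Test s ->
      exists (E : Sys) (C : V A (B ⊗ E)) (es : seq (V E I)),
        channel C /\ Test es /\
        s = [seq castV erefl (tensI_r T B) (comp (par (idt T B) e) C) | e <- es];
  state_sep : forall (A : Sys) (rho sigma : V I A),
      (forall a : V A I, Tr a -> prb a rho = prb a sigma) -> rho = sigma;
  effect_sep : forall (A : Sys) (a b : V A I),
      (forall rho : V I A, Tr rho -> prb a rho = prb b rho) -> a = b;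
  transf_sep : forall (A B : Sys) (f g : V A B),
      (forall (E : Sys) (rho : V I (A ⊗ E)), Tr rho ->
         comp (par f (idt T E)) rho = comp (par g (idt T E)) rho) -> f = g;
  Tr_convex : forall (A B : Sys) (f g : V A B) (p : R), Tr f -> Tr g ->
      0 <= p <= 1 -> Tr (p *: f + (1 - p) *: g);
  Tr_compact : forall A B : Sys,
      compact [set coords v | v in [set f : V A B | Tr f]]
}.

Record sharp_with_purification : Prop := {
  causality_unique : forall A : Sys,
      exists u : V A I, det_effect u /\ forall u' : V A I, det_effect u' -> u' = u;
  causality_sum : forall (A : Sys) (s : seq (V A I)) (u : V A I),
      Test s -> det_effect u -> \sum_(e <- s) e = u;
  purity_pres_seq : forall (A B C : Sys) (g : V B C) (f : V A B),
      pure f -> pure g -> pure (comp g f);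
  purity_pres_par : forall (A B C D : Sys) (f : V A B) (g : V C D),
      pure f -> pure g -> pure (par f g);
  pure_sharpness : forall A : Sys,
      exists a : V A I, pure a /\ exists rho : V I A, Tr rho /\ prb a rho = 1;
  purif_exists : forall (A : Sys) (rho : V I A), norm_state rho ->
      exists (B : Sys) (Psi : V I (A ⊗ B)), purification rho Psi;
  purif_unique : forall (A B : Sys) (rho : V I A) (Psi Psi' : V I (A ⊗ B)),
      purification rho Psi -> purification rho Psi' ->
      exists U : V B B, reversible U /\ Psi' = comp (par (idt T A) U) Psi
}.

End OPTDefs.

(* Main.v *)
(* An effect sharp on a pure state determines the state, because a state on
   which a pure effect is certain is pure, and so is every mixture of such
   states.  Any two pure states are related by a reversible channel, so every
   pure state admits a sharp pure effect.

   The delicate point is that this effect is unique: since states are not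
   assumed to be closed under conditioning, a state steered by a pure effect
   need not be proportional to a normalized one.  Instead, the mixture of the
   channels [x |-> x (x) al] and [x |-> al (x) x] is purified to a pure
   transformation [W] with a control system.  An effect [h] that is sharp on
   the control state of [W al] recombines two sharp effects [a], [a'] of [al]
   coherently into a pure effect below their mixture.  Iterating the
   recombination from the deterministic effect gives a decreasing sequence,
   whose decrements bound the loss [mid a' a - Hop a' a h] from above; hence
   the loss vanishes, the mixture of [a] and [a'] is pure, and [a = a']. *)

Require Import Defs.
From HB Require Import structures.
From mathcomp Require Import all_boot all_order all_algebra.
From mathcomp Require Import all_classical all_reals all_analysis.
From mathcomp Require Import ring lra.

Set Implicit Arguments.
Unset Strict Implicit.
Unset Printing Implicit Defensive.

Import Order.TTheory GRing.Theory Num.Theory.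
Import numFieldNormedType.Exports.
Local Open Scope ring_scope.

Section Theory.
Context {R : realType} {T : OPTData R}.
Hypothesis HT : OPT_axioms T.

Local Notation Sys := (Sys T).
Local Notation I := (Iu T).
Local Notation "A ⊗ B" := (tens T A B) (at level 40, left associativity).
Local Notation V := (V T).
Local Notation "g ∘ f" := (Defs.comp g f) (at level 40, left associativity).
Local Notation "1_ A" := (idt T A) (at level 8, A at level 2, format "1_ A").

Implicit Types A B C D E : Sys.

(** * Linear calculus of sequential composition, parallel composition and scalars *)

Lemma compA A B C D (h : V C D) (g : V B C) (f : V A B) :
  h ∘ (g ∘ f) = h ∘ g ∘ f.
Proof. exact: comp_assoc HT _ _ _ _ _ _ _. Qed.

Lemma comp1l A B (f : V A B) : 1_B ∘ f = f.
Proof. exact: comp_id_l HT _ _ _. Qed.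

Lemma comp1r A B (f : V A B) : f ∘ 1_A = f.
Proof. exact: comp_id_r HT _ _ _. Qed.

Lemma compDl A B C (g g' : V B C) (f : V A B) : (g + g') ∘ f = g ∘ f + g' ∘ f.
Proof. by have := comp_linear_l HT 1 g g' f; rewrite !scale1r. Qed.

Lemma compDr A B C (g : V B C) (f f' : V A B) : g ∘ (f + f') = g ∘ f + g ∘ f'.
Proof. by have := comp_linear_r HT 1 g f f'; rewrite !scale1r. Qed.

Lemma comp0l A B C (f : V A B) : (0 : V B C) ∘ f = 0.
Proof. by apply: (addrI ((0 : V B C) ∘ f)); rewrite -compDl !addr0. Qed.

Lemma comp0r A B C (g : V B C) : g ∘ (0 : V A B) = 0.
Proof. by apply: (addrI (g ∘ 0)); rewrite -compDr !addr0. Qed.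

Lemma compZl A B C (k : R) (g : V B C) (f : V A B) : (k *: g) ∘ f = k *: (g ∘ f).
Proof. by have := comp_linear_l HT k g 0 f; rewrite comp0l !addr0. Qed.

Lemma compZr A B C (k : R) (g : V B C) (f : V A B) : g ∘ (k *: f) = k *: (g ∘ f).
Proof. by have := comp_linear_r HT k g f 0; rewrite comp0r !addr0. Qed.

Lemma parDl A B C D (f f' : V A B) (g : V C D) :
  par (f + f') g = par f g + par f' g.
Proof. by have := par_linear_l HT 1 f f' g; rewrite !scale1r. Qed.

Lemma parDr A B C D (f : V A B) (g g' : V C D) :
  par f (g + g') = par f g + par f g'.
Proof. by have := par_linear_r HT 1 f g g'; rewrite !scale1r. Qed.

Lemma par0l A B C D (g : V C D) : par (0 : V A B) g = 0.
Proof. by apply: (addrI (par (0 : V A B) g)); rewrite -parDl !addr0. Qed.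

Lemma par0r A B C D (f : V A B) : par f (0 : V C D) = 0.
Proof. by apply: (addrI (par f (0 : V C D))); rewrite -parDr !addr0. Qed.

Lemma parZl A B C D (k : R) (f : V A B) (g : V C D) :
  par (k *: f) g = k *: par f g.
Proof. by have := par_linear_l HT k f 0 g; rewrite par0l !addr0. Qed.

Lemma parZr A B C D (k : R) (f : V A B) (g : V C D) :
  par f (k *: g) = k *: par f g.
Proof. by have := par_linear_r HT k f g 0; rewrite par0r !addr0. Qed.

Lemma parM A B C A' B' C' (g : V B C) (f : V A B) (g' : V B' C') (f' : V A' B') :
  par g g' ∘ par f f' = par (g ∘ f) (g' ∘ f').
Proof. by rewrite (par_comp HT). Qed.

Lemma par11 A B : par 1_A 1_B = 1_(A ⊗ B).
Proof. exact: par_id HT A B. Qed.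

Lemma scalD (p q : V I I) : scal (p + q) = scal p + scal q.
Proof. by have := scal_linear HT 1 p q; rewrite scale1r mul1r. Qed.

Lemma scal0 : scal (0 : V I I) = 0.
Proof. by apply: (addrI (scal (0 : V I I))); rewrite -scalD !addr0. Qed.

Lemma scalZ k (p : V I I) : scal (k *: p) = k * scal p.
Proof. by have := scal_linear HT k p 0; rewrite scal0 !addr0. Qed.

Lemma scal_eq (p : V I I) : p = scal p *: 1_I.
Proof. by apply: (scal_inj HT); rewrite scalZ (scal_id HT) mulr1. Qed.

Section Prb.
Variable A : Sys.
Implicit Types (a b : V A I) (x y : V I A).
Lemma prbDl a b x : prb (a + b) x = prb a x + prb b x.
Proof. by rewrite /prb compDl scalD. Qed.

Lemma prbDr a x y : prb a (x + y) = prb a x + prb a y.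
Proof. by rewrite /prb compDr scalD. Qed.

Lemma prbZl k a x : prb (k *: a) x = k * prb a x.
Proof. by rewrite /prb compZl scalZ. Qed.

Lemma prbZr k a x : prb a (k *: x) = k * prb a x.
Proof. by rewrite /prb compZr scalZ. Qed.

Lemma prb0l x : prb (0 : V A I) x = 0.
Proof. by rewrite /prb comp0l scal0. Qed.

Lemma prb0r a : prb a 0 = 0.
Proof. by rewrite /prb comp0r scal0. Qed.

Lemma prbNl a x : prb (- a) x = - prb a x.
Proof. by rewrite -scaleN1r prbZl mulN1r. Qed.

Lemma prbBl a b x : prb (a - b) x = prb a x - prb b x.
Proof. by rewrite prbDl prbNl. Qed.
End Prb.

Lemma prb_comp A B (a : V B I) (f : V A B) (x : V I A) :
  prb (a ∘ f) x = prb a (f ∘ x).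
Proof. by rewrite /prb compA. Qed.

(* The object equalities act as structural isomorphisms; by proof irrelevance
   any two of them with the same endpoints agree, so no coherence is needed. *)
Definition iota A B (e : A = B) : V A B := castV erefl e 1_A.

Lemma castVE A A' B B' (eA : A = A') (eB : B = B') (f : V A B) :
  castV eA eB f = iota eB ∘ f ∘ iota (esym eA).
Proof. by case: A' / eA; case: B' / eB; rewrite /iota /= comp1l comp1r. Qed.

Lemma iota_irr A B (e e' : A = B) : iota e = iota e'.
Proof. by rewrite (Prop_irrelevance e e'). Qed.

Lemma iota1 A (e : A = A) : iota e = 1_A.
Proof. exact: (iota_irr e erefl). Qed.

Lemma iotaM A B C (e : A = B) (e' : B = C) : iota e' ∘ iota e = iota (etrans e e').
Proof. by case: C / e'; rewrite iota1 comp1l. Qed.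

Lemma iotaK A B (e : A = B) (e' : B = A) : iota e' ∘ iota e = 1_A.
Proof. by rewrite iotaM iota1. Qed.

Lemma par_iota A B C D (e : A = B) (e' : C = D) :
  par (iota e) (iota e') = iota (f_equal2 (tens T) e e').
Proof. by case: B / e; case: D / e'; rewrite !iota1 par11. Qed.

Lemma par_assocE A B C A' B' C' (f : V A A') (g : V B B') (h : V C C') :
  iota (tensA T A' B' C') ∘ par f (par g h) =
  par (par f g) h ∘ iota (tensA T A B C).
Proof.
by rewrite -(par_assoc HT) castVE -!compA iotaM iota1 comp1r.
Qed.

(** The equality proofs [e] and [e'] are arbitrary, so that the lemma rewrites under whichever proof
    happens to occur. *)
Lemma unitr_nat A B (f : V A B) (e : B ⊗ I = B) (e' : A ⊗ I = A) :
  iota e ∘ par f 1_I = f ∘ iota e'.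
Proof.
have := par_I_r HT 1_I f; rewrite (scal_id HT) scale1r castVE => E.
by rewrite -[in RHS]E -!compA iotaM (iota1 (etrans _ _)) comp1r (iota_irr _ e).
Qed.

Lemma unitl_nat A B (f : V A B) (e : I ⊗ B = B) (e' : I ⊗ A = A) :
  iota e ∘ par 1_I f = f ∘ iota e'.
Proof.
have := par_I_l HT 1_I f; rewrite (scal_id HT) scale1r castVE => E.
by rewrite -[in RHS]E -!compA iotaM (iota1 (etrans _ _)) comp1r (iota_irr _ e).
Qed.

(** * Adjoining a state to a system and applying an effect to one factor, with the trivial system
    absorbed *)

Definition insr A B C (f : V A C) (b : V I B) : V A (C ⊗ B) :=
  par f b ∘ iota (esym (tensI_r T A)).
Definition insl A B C (b : V I B) (f : V A C) : V A (B ⊗ C) :=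
  par b f ∘ iota (esym (tensI_l T A)).
Definition effr A B C (f : V A C) (b : V B I) : V (A ⊗ B) C :=
  iota (tensI_r T C) ∘ par f b.
Definition effl A B C (b : V B I) (f : V A C) : V (B ⊗ A) C :=
  iota (tensI_l T C) ∘ par b f.

Lemma effr_par A B C A' B' (f : V A C) (b : V B I) (g : V A' A) (h : V B' B) :
  effr f b ∘ par g h = effr (f ∘ g) (b ∘ h).
Proof. by rewrite /effr -compA parM. Qed.

Lemma effl_par A B C A' B' (f : V A C) (b : V B I) (g : V A' A) (h : V B' B) :
  effl b f ∘ par h g = effl (b ∘ h) (f ∘ g).
Proof. by rewrite /effl -compA parM. Qed.

Lemma par_insr A B C B' C' (f : V A C) (b : V I B) (g : V C C') (h : V B B') :
  par g h ∘ insr f b = insr (g ∘ f) (h ∘ b).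
Proof. by rewrite /insr compA parM. Qed.

Lemma par_insl A B C B' C' (f : V A C) (b : V I B) (g : V C C') (h : V B B') :
  par h g ∘ insl b f = insl (h ∘ b) (g ∘ f).
Proof. by rewrite /insl compA parM. Qed.

Lemma comp_effr A B C D (h : V C D) (f : V A C) (b : V B I) :
  h ∘ effr f b = effr (h ∘ f) b.
Proof.
by rewrite /effr compA -(unitr_nat h (tensI_r T D)) -compA parM comp1l.
Qed.

Lemma comp_effl A B C D (h : V C D) (f : V A C) (b : V B I) :
  h ∘ effl b f = effl b (h ∘ f).
Proof.
by rewrite /effl compA -(unitl_nat h (tensI_l T D)) -compA parM comp1l.
Qed.

Lemma iota_shift A B C (e : A = B) (e' : B = A) (f : V A C) (g : V B C) :
  f ∘ iota e' = g -> f = g ∘ iota e.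
Proof. by move<-; rewrite -compA iotaK comp1r. Qed.

Lemma insr_comp A B C D (k : V D A) (f : V A C) (b : V I B) :
  insr f b ∘ k = insr (f ∘ k) b.
Proof.
rewrite /insr -[X in par (f ∘ k) X]comp1r -parM -!compA; congr (_ ∘ _).
apply: (@iota_shift _ _ _ _ (tensI_r T D)); rewrite -compA.
rewrite -(unitr_nat k (tensI_r T A)) compA iotaK comp1l.
by [].
Qed.

Lemma insl_comp A B C D (k : V D A) (f : V A C) (b : V I B) :
  insl b f ∘ k = insl b (f ∘ k).
Proof.
rewrite /insl -[X in par X (f ∘ k)]comp1r -parM -!compA; congr (_ ∘ _).
apply: (@iota_shift _ _ _ _ (tensI_l T D)); rewrite -compA.
rewrite -(unitl_nat k (tensI_l T A)) compA iotaK comp1l.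
by [].
Qed.

Lemma effr_insr A B C D (f : V A C) (b : V B I) (g : V D A) (x : V I B) :
  effr f b ∘ insr g x = prb b x *: (f ∘ g).
Proof.
rewrite /effr /insr -compA [X in _ ∘ X]compA parM (scal_eq (b ∘ x)) parZr.
rewrite compZl compZr; congr (_ *: _).
by rewrite compA (unitr_nat _ _ (tensI_r T D)) -compA iotaK comp1r.
Qed.

Lemma effl_insl A B C D (f : V A C) (b : V B I) (g : V D A) (x : V I B) :
  effl b f ∘ insl x g = prb b x *: (f ∘ g).
Proof.
rewrite /effl /insl -compA [X in _ ∘ X]compA parM (scal_eq (b ∘ x)) parZl.
rewrite compZl compZr; congr (_ *: _).
by rewrite compA (unitl_nat _ _ (tensI_l T D)) -compA iotaK comp1r.
Qed.

Lemma margE A B (u : V B I) (P : V I (A ⊗ B)) : marg u P = effr 1_A u ∘ P.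
Proof.
by rewrite /marg castVE /effr iota1 comp1r compA.
Qed.

Lemma comp_sumr A B C (g : V B C) (s : seq (V A B)) :
  g ∘ (\sum_(x <- s) x) = \sum_(x <- s) g ∘ x.
Proof.
by apply: (big_morph _ (id1 := 0) (op1 := +%R)) => [x y|]; rewrite ?compDr ?comp0r.
Qed.

(** * Closure properties of transformations, channels and pure transformations *)

Lemma TrM A B C (g : V B C) (f : V A B) : Tr g -> Tr f -> Tr (g ∘ f).
Proof.
move=> /(Tr_test HT) [t [Ht gt]] /(Tr_test HT) [s [Hs fs]].
apply/(Tr_test HT); eexists; split; first exact: (test_seq HT Hs Ht).
by apply/allpairsP; exists (f, g).
Qed.

Lemma Tr_par A B C D (f : V A B) (g : V C D) : Tr f -> Tr g -> Tr (par f g).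
Proof.
move=> /(Tr_test HT) [s [Hs fs]] /(Tr_test HT) [t [Ht gt]].
apply/(Tr_test HT); eexists; split; first exact: (test_par HT Hs Ht).
by apply/allpairsP; exists (f, g).
Qed.

Lemma Tr_chan A B (f : V A B) : channel f -> Tr f.
Proof. by move=> Hf; apply/(Tr_test HT); exists [:: f]; rewrite mem_head. Qed.

Lemma chanM A B C (g : V B C) (f : V A B) : channel g -> channel f -> channel (g ∘ f).
Proof. by move=> Hg Hf; exact: (test_seq HT Hf Hg). Qed.

Lemma chan_par A B C D (f : V A B) (g : V C D) :
  channel f -> channel g -> channel (par f g).
Proof. by move=> Hf Hg; exact: (test_par HT Hf Hg). Qed.

Lemma chan1 A : channel 1_A. Proof. exact: test_id HT A. Qed.

Lemma Tr1 A : Tr 1_A. Proof. exact/Tr_chan/chan1. Qed.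

Lemma chan_iota A B (e : A = B) : channel (iota e).
Proof. by case: B / e; rewrite iota1; exact: chan1. Qed.

Lemma Tr_iota A B (e : A = B) : Tr (iota e).
Proof. exact/Tr_chan/chan_iota. Qed.

Lemma Tr_effr A B C (f : V A C) (b : V B I) : Tr f -> Tr b -> Tr (effr f b).
Proof. by move=> Hf Hb; apply: TrM (Tr_iota _) _; exact: Tr_par. Qed.

Lemma Tr_effl A B C (f : V A C) (b : V B I) : Tr f -> Tr b -> Tr (effl b f).
Proof. by move=> Hf Hb; apply: TrM (Tr_iota _) _; exact: Tr_par. Qed.

Lemma rev_iota A B (e : A = B) : reversible (iota e).
Proof.
split; first exact: chan_iota.
by exists (iota (esym e)); rewrite !iotaK; split; first exact: chan_iota.
Qed.

Lemma rev1 A : reversible 1_A.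
Proof. by rewrite -(iota1 erefl); exact: rev_iota. Qed.

Lemma rev_par A B C D (f : V A B) (g : V C D) :
  reversible f -> reversible g -> reversible (par f g).
Proof.
move=> [cf [f' [cf' [fK fK']]]] [cg [g' [cg' [gK gK']]]].
split; first exact: chan_par.
exists (par f' g'); split; first exact: chan_par.
by rewrite !parM fK fK' gK gK' !par11.
Qed.

Lemma pure_Tr A B (f : V A B) : pure f -> Tr f. Proof. by case. Qed.

Lemma pure_split A B (f d d' : V A B) r : pure f -> Test [:: d, d' & r] ->
  f = d + d' -> exists2 p, 0 <= p & d = p *: f.
Proof.
(* The mask is shorter than the test, so it selects [d] and [d'] and drops all of [r]. *)
move=> [_ Pf] Ht E; have [| |p [p0 ->]] := Pf _ [:: true; true] Ht _ d.
- by rewrite /= mask0s !big_cons big_nil addr0.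
- by rewrite /= mask0s mem_head.
- by exists p.
Qed.

Lemma test_map_l A B C (g : V B C) (s : seq (V A B)) :
  channel g -> Test s -> Test [seq g ∘ x | x <- s].
Proof.
move=> cg Hs; have := test_seq HT Hs cg.
by rewrite allpairs1r.
Qed.

Lemma test_map_r A B C (f : V A B) (s : seq (V B C)) :
  channel f -> Test s -> Test [seq x ∘ f | x <- s].
Proof.
move=> cf Hs; have := test_seq HT cf Hs.
by rewrite allpairs1l.
Qed.

(** Applying the inverse channel turns a refinement of [g ∘ f] into a refinement of [f]. *)
Lemma pure_rev_l A B C (g : V B C) (f : V A B) :
  reversible g -> pure f -> pure (g ∘ f).
Proof.
move=> [cg [g' [cg' [gK gK']]]] [Tf Pf]; split; first exact: TrM (Tr_chan cg) Tf.
move=> s m Hs E D Dm.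
have [||p [p0 Ep]] := Pf _ m (test_map_l cg' Hs) _ (g' ∘ D).
- rewrite -map_mask big_map -comp_sumr.
  by rewrite -E compA gK comp1l.
- by rewrite -map_mask map_f.
exists p; split=> //.
by rewrite -[D]comp1l -gK' -compA Ep compZr.
Qed.

Lemma compl_suml A B C (f : V A B) (s : seq (V B C)) :
  (\sum_(x <- s) x) ∘ f = \sum_(x <- s) x ∘ f.
Proof.
apply: (big_morph (fun g => g ∘ f) (id1 := 0) (op1 := +%R)) => [x y|].
  by rewrite compDl.
by rewrite comp0l.
Qed.

Lemma pure_rev_r A B C (g : V B C) (f : V A B) :
  reversible f -> pure g -> pure (g ∘ f).
Proof.
move=> [cf [f' [cf' [fK fK']]]] [Tg Pg]; split; first exact: TrM Tg (Tr_chan cf).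
move=> s m Hs E D Dm.
have [||p [p0 Ep]] := Pg _ m (test_map_r cf' Hs) _ (D ∘ f').
- rewrite -map_mask big_map -compl_suml.
  by rewrite -E -compA fK' comp1r.
- by rewrite -map_mask; apply: (map_f (fun x => x ∘ f')).
exists p; split=> //.
by rewrite -[D]comp1r -fK compA Ep compZl.
Qed.

(** * Causality *)

Hypothesis HS : sharp_with_purification T.

Definition uu A : V A I := projT1 (cid (causality_unique HS A)).
Lemma uuP A : det_effect (uu A).
Proof. by rewrite /uu; case: cid => u []. Qed.

Lemma uu_uniq A (u : V A I) : det_effect u -> u = uu A.
Proof. by rewrite /uu; case: cid => v [Hv H] /H. Qed.

Lemma Tr_uu A : Tr (uu A). Proof. exact/Tr_chan/uuP. Qed.

Lemma uu_chan A B (f : V A B) : channel f -> uu B ∘ f = uu A.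
Proof. by move=> cf; apply: uu_uniq; apply: chanM cf; exact: uuP. Qed.

Lemma uuI : uu I = 1_I.
Proof. by apply/esym/uu_uniq/chan1. Qed.

Lemma uu_effr A B : effr (uu A) (uu B) = uu (A ⊗ B).
Proof.
by apply: uu_uniq; apply: chanM (chan_iota _) _; apply: chan_par; exact: uuP.
Qed.

Lemma test_sum A (s : seq (V A I)) : Test s -> \sum_(e <- s) e = uu A.
Proof. by move=> Hs; exact: (causality_sum HS Hs (uuP A)). Qed.

Lemma test_compl A (a : V A I) : Tr a -> Test [:: a; uu A - a].
Proof.
move=> /(Tr_test HT) [s [Hs a_s]].
(* All outcomes other than [a] are merged; by Causality their sum is [uu A - a]. *)
have /(test_coarse HT) : Test (rem a s ++ [:: a]).
  by apply: (test_perm HT Hs); rewrite perm_sym perm_catC perm_sym; exact: perm_to_rem.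
have -> : \sum_(x <- rem a s) x = uu A - a.
  by rewrite -(test_sum Hs) (perm_big _ (perm_to_rem a_s)) big_cons addrC addKr.
by move=> Ht; apply: (test_perm HT Ht); rewrite -(perm_catC [:: _] [:: _]).
Qed.

Lemma Tr_compl A (a : V A I) : Tr a -> Tr (uu A - a).
Proof.
move=> /test_compl Ht; apply/(Tr_test HT); eexists; split; first exact: Ht.
by rewrite !inE eqxx orbT.
Qed.

Lemma prb_ge0 A (a : V A I) (x : V I A) : Tr a -> Tr x -> 0 <= prb a x.
Proof. by move=> Ta Tx; have /andP[] := scal_prob HT (TrM Ta Tx). Qed.

Lemma prb_le1 A (a : V A I) (x : V I A) : Tr a -> Tr x -> prb a x <= 1.
Proof. by move=> Ta Tx; have /andP[] := scal_prob HT (TrM Ta Tx). Qed.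

Lemma prb_leu A (a : V A I) (x : V I A) : Tr a -> Tr x -> prb a x <= prb (uu A) x.
Proof. by move=> Ta Tx; rewrite -subr_ge0 -prbBl prb_ge0 //; exact: Tr_compl. Qed.

(** Every effect is dominated by [uu A], so all effects vanish on [x]. *)
Lemma Tr_eq0 A (x : V I A) : Tr x -> prb (uu A) x = 0 -> x = 0.
Proof.
move=> Tx x0; apply: (state_sep HT) => a Ta; rewrite prb0r.
by apply/eqP; rewrite eq_le prb_ge0 // andbT -x0 prb_leu.
Qed.

Lemma norm_stateE A (x : V I A) : norm_state x <-> Tr x /\ prb (uu A) x = 1.
Proof.
split=> -[Tx Hx]; split=> //; first exact/Hx/uuP.
by move=> u /uu_uniq ->.
Qed.

Lemma chan_norm A (x : V I A) : channel x -> norm_state x.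
Proof.
move=> cx; apply/norm_stateE; split; first exact: Tr_chan.
by rewrite /prb uu_chan // uuI (scal_id HT).
Qed.

(** The state occurs in some test and already has probability 1 there. The other outcomes have
    probability zero, hence vanish, and coarse-graining the test leaves [x] alone. *)
Lemma norm_chan A (x : V I A) : norm_state x -> channel x.
Proof.
move=> /norm_stateE [/(Tr_test HT) [s [Hs xs]] x1].
have Hu : Test [seq uu A ∘ y | y <- s] := test_map_l (uuP A) Hs.
have := test_sum Hu; rewrite uuI big_map => /(congr1 (@scal R T)).
rewrite (scal_id HT).
have Hs' : Test (x :: rem x s) := test_perm HT Hs (perm_to_rem xs).
have -> : forall r : seq (V I A), scal (\sum_(y <- r) (uu A ∘ y)) = \sum_(y <- r) prb (uu A) y.
  by move=> r; apply: (big_morph _ scalD scal0).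
rewrite (perm_big _ (perm_to_rem xs)) big_cons x1 -[RHS]addr0 => /addrI E.
have Tr_r y : y \in rem x s -> Tr y.
  by move=> yr; apply/(Tr_test HT); exists s; split=> //; exact: mem_rem yr.
have /eqP := E; rewrite big_seq psumr_eq0; last first.
  by move=> y /Tr_r Ty; exact: prb_ge0 (Tr_uu A) Ty.
move=> /allP r0.
have : Test ((\sum_(y <- x :: rem x s) y) :: [::]).
  by apply: (test_coarse HT); rewrite cats0.
rewrite big_cons big_seq big1 ?addr0// => y yr.
apply: Tr_eq0; first exact: Tr_r.
by have := r0 _ yr; rewrite yr => /eqP.
Qed.

Lemma norm_Tr A (x : V I A) : norm_state x -> Tr x. Proof. by case. Qed.

Lemma norm_u A (x : V I A) : norm_state x -> prb (uu A) x = 1.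
Proof. by move=> /norm_stateE []. Qed.

Lemma norm_comp A B (f : V A B) (x : V I A) :
  Tr f -> uu B ∘ f = uu A -> norm_state x -> norm_state (f ∘ x).
Proof.
move=> Tf uf nx; apply/norm_stateE; split; first exact: TrM Tf (norm_Tr nx).
by rewrite -prb_comp uf norm_u.
Qed.

Lemma norm_chan_comp A B (f : V A B) (x : V I A) :
  channel f -> norm_state x -> norm_state (f ∘ x).
Proof. by move=> cf; apply: norm_comp (Tr_chan cf) (uu_chan cf). Qed.

Lemma norm_neq0 A (x : V I A) : norm_state x -> x != 0.
Proof.
by move=> /norm_u x1; apply/eqP => x0; move: x1; rewrite x0 prb0r => /esym/eqP; rewrite oner_eq0.
Qed.

Lemma chan_insr A B (b : V I B) : norm_state b -> channel (insr 1_A b).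
Proof.
by move=> nb; apply: chanM (chan_iota _); apply: chan_par (chan1 _) (norm_chan nb).
Qed.

Lemma chan_insl A B (b : V I B) : norm_state b -> channel (insl b 1_A).
Proof.
by move=> nb; apply: chanM (chan_iota _); apply: chan_par (norm_chan nb) (chan1 _).
Qed.

Lemma norm_insr A B (x : V I A) (y : V I B) :
  norm_state x -> norm_state y -> norm_state (insr x y).
Proof.
move=> nx ny; rewrite -[x]comp1l -insr_comp.
exact: norm_chan_comp (chan_insr A ny) nx.
Qed.

(** Realizing a test with trivial input makes its channel a normalized state. This stands in for
    rescaling a subnormalized state to a normalized one. *)
Lemma state_dilation A (x : V I A) : Tr x ->
  exists E (C : V I (A ⊗ E)) (e : V E I),
    [/\ norm_state C, Tr e & x = effr 1_A e ∘ C].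
Proof.
move=> /(Tr_test HT) [s [Hs xs]].
have [E [C [es [cC [tes Es]]]]] := test_realize HT Hs.
move: xs; rewrite Es => /mapP [e ees ->]; exists E, C, e.
split; first exact: chan_norm.
  by apply/(Tr_test HT); exists es.
by rewrite -margE.
Qed.

(** * Reassociation of local effects *)

Lemma par_assoc_r A B C A' B' C' (f : V A A') (g : V B B') (h : V C C')
    (e : A' ⊗ B' ⊗ C' = A' ⊗ (B' ⊗ C')) (e' : A ⊗ B ⊗ C = A ⊗ (B ⊗ C)) :
  par f (par g h) ∘ iota e' = iota e ∘ par (par f g) h.
Proof.
have := par_assocE f g h => /(congr1 (fun z => iota e ∘ z ∘ iota e')).
by rewrite -!compA iotaK comp1r !compA iotaK comp1l => ->.
Qed.

Lemma effr_assoc A B C D (f : V A D) (b : V B I) (c : V C I)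
    (e : A ⊗ B ⊗ C = A ⊗ (B ⊗ C)) :
  effr f (effr b c) ∘ iota e = effr (effr f b) c.
Proof.
rewrite /effr -[in par f _](comp1l f) -[in RHS](comp1l c) -!parM -!compA.
rewrite (par_assoc_r f b c (esym (tensA T D I I))) !compA; congr (_ ∘ _).
rewrite -[1_D](iota1 erefl) -[1_I](iota1 erefl) !par_iota !iotaM.
exact: iota_irr.
Qed.

Lemma effl_assoc A B C D (f : V A D) (b : V B I) (c : V C I)
    (e : B ⊗ C ⊗ A = B ⊗ (C ⊗ A)) :
  effl b (effl c f) ∘ iota e = effl (effl b c) f.
Proof.
rewrite /effl -[in par b _](comp1l b) -[in RHS](comp1l f) -!parM -!compA.
rewrite (par_assoc_r b c f (esym (tensA T I I D))) !compA; congr (_ ∘ _).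
rewrite -[1_D](iota1 erefl) -[1_I](iota1 erefl) !par_iota !iotaM.
exact: iota_irr.
Qed.

Lemma effr_par1 A B C A' B' (f : V A A') (g : V B B') (c : V C I)
    (e : A ⊗ B ⊗ C = A ⊗ (B ⊗ C)) :
  par f (effr g c) ∘ iota e = effr (par f g) c.
Proof.
rewrite /effr -[in par f _](comp1l f) -parM -!compA.
rewrite (par_assoc_r f g c (esym (tensA T A' B' I))) !compA; congr (_ ∘ _).
rewrite -[1_A'](iota1 erefl) !par_iota !iotaM.
exact: iota_irr.
Qed.

Lemma effl_par1 A B C A' B' (f : V A A') (g : V B B') (c : V C I)
    (e : C ⊗ A ⊗ B = C ⊗ (A ⊗ B)) :
  effl c (par f g) ∘ iota e = par (effl c f) g.
Proof.
rewrite /effl -[in RHS](comp1l g) -parM -!compA.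
rewrite (par_assoc_r c f g (esym (tensA T I A' B'))) !compA; congr (_ ∘ _).
rewrite -[1_B'](iota1 erefl) !par_iota !iotaM.
exact: iota_irr.
Qed.

Lemma insr_insl A B (x : V I A) (y : V I B) : insr x y = insl x y.
Proof. by rewrite /insr /insl; congr (_ ∘ _); exact: iota_irr. Qed.

Lemma effr_effl A B (a : V A I) (b : V B I) : effr a b = effl a b.
Proof. by rewrite /effr /effl; congr (_ ∘ _); exact: iota_irr. Qed.

Lemma effrDr A B C (f : V A C) (b b' : V B I) : effr f (b + b') = effr f b + effr f b'.
Proof. by rewrite /effr parDr compDr. Qed.

Lemma effr0r A B C (f : V A C) : effr f (0 : V B I) = 0.
Proof. by rewrite /effr par0r comp0r. Qed.

Lemma effr0l A B C (b : V B I) : effr (0 : V A C) b = 0.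
Proof. by rewrite /effr par0l comp0r. Qed.

Lemma chan_effr A B C (f : V A C) : channel f -> channel (effr f (uu B)).
Proof. by move=> cf; apply: chanM (chan_iota _) _; apply: chan_par => //; exact: uuP. Qed.

Lemma chan_effl A B C (f : V A C) : channel f -> channel (effl (uu B) f).
Proof. by move=> cf; apply: chanM (chan_iota _) _; apply: chan_par => //; exact: uuP. Qed.

Lemma pure_insr A B (x : V I A) (y : V I B) : pure x -> pure y -> pure (insr x y).
Proof.
by move=> px py; apply: pure_rev_r (rev_iota _) _; exact: (purity_pres_par HS).
Qed.

(** * Purification, and states with a pure marginal *)

Lemma purify A (x : V I A) : norm_state x ->
  exists B (P : V I (A ⊗ B)), [/\ pure P, norm_state P & effr 1_A (uu B) ∘ P = x].
Proof.
move=> /(purif_exists HS) [B [P [pP [nP mP]]]]; exists B, P; split => //.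
by rewrite -margE mP //; exact: uuP.
Qed.

Lemma purif_rev A B (P Q : V I (A ⊗ B)) :
  pure P -> norm_state P -> pure Q -> norm_state Q ->
  effr 1_A (uu B) ∘ P = effr 1_A (uu B) ∘ Q ->
  exists2 U : V B B, reversible U & Q = par 1_A U ∘ P.
Proof.
move=> pP nP pQ nQ E.
have H (S : V I (A ⊗ B)) : pure S -> norm_state S ->
    purification (effr 1_A (uu B) ∘ S) S.
  by move=> pS nS; split => //; split => // u /uu_uniq ->; rewrite margE.
have [||U [rU ->]] := purif_unique HS (rho := effr 1_A (uu B) ∘ P) (Psi := P) (Psi' := Q).
- exact: H.
- by rewrite E; exact: H.
by exists U.
Qed.

Lemma swap_chan A B : channel (swap T A B).
Proof. by case: (swap_rev HT A B). Qed.

(** A purification [P'] of [S] also purifies the pure marginal [x], and so does a product of [x]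
    with any pure state. Uniqueness of purification makes [P'] a local transform of such a product,
    hence itself a product. *)
Lemma product_state A B (S : V I (A ⊗ B)) : norm_state S ->
  pure (effr 1_A (uu B) ∘ S) ->
  exists2 y : V I B, norm_state y & S = insr (effr 1_A (uu B) ∘ S) y.
Proof.
move=> nS; set x := effr _ _ ∘ S => px.
have nx : norm_state x := norm_chan_comp (chan_effr B (chan1 A)) nS.
have [Z [P [pP nP mP]]] := purify nS.
pose P' := iota (esym (tensA T A B Z)) ∘ P.
have pP' : pure P' := pure_rev_l (rev_iota _) pP.
have nP' : norm_state P' := norm_chan_comp (chan_iota _) nP.
have mP' : effr 1_A (uu (B ⊗ Z)) ∘ P' = x.
  by rewrite -uu_effr /P' compA effr_assoc -[effr 1_A (uu B)]comp1r -comp_effr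
    -compA mP.
(* To compare purifications with the same purifying system [W ⊗ A], one copy of [x] is placed in
   front of the swapped [P'] and another behind [P']. *)
pose W := B ⊗ Z; pose Q := swap T A W ∘ P'.
have pQ : pure Q := pure_rev_l (swap_rev HT _ _) pP'.
have nQ : norm_state Q := norm_chan_comp (swap_chan _ _) nP'.
pose P1 := iota (esym (tensA T A W A)) ∘ insr P' x.
have [|||||U rU EU] := purif_rev (P := insr x Q) (Q := P1).
- exact: pure_insr.
- exact: norm_insr.
- exact: pure_rev_l (rev_iota _) (pure_insr pP' px).
- exact: norm_chan_comp (chan_iota _) (norm_insr nP' nx).
- rewrite effr_insr comp1l norm_u// scale1r -uu_effr /P1 compA effr_assoc.
  by rewrite effr_insr norm_u// scale1r mP'.
have EP : P' = insr x (effr 1_W (uu A) ∘ (U ∘ Q)).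
  have : effr 1_(A ⊗ W) (uu A) ∘ insr P' x = P'.
    by rewrite effr_insr norm_u// scale1r comp1l.
  rewrite -par11 -(effr_par1 _ _ _ (esym (tensA T A W A))) -compA -/P1 EU.
  by rewrite par_insr comp1l par_insr comp1l => ->.
exists (effr 1_B (uu Z) ∘ (effr 1_W (uu A) ∘ (U ∘ Q))).
  do ! [apply: norm_chan_comp; first exact: chan_effr (chan1 _)].
  by apply: norm_chan_comp nQ; case: rU.
rewrite -[in LHS]mP -par11 -(effr_par1 _ _ _ (esym (tensA T A B Z))) -compA -/P'.
by rewrite {1}EP par_insr comp1l.
Qed.

Lemma Tr_transf0 A B (f : V A B) : Tr f -> uu B ∘ f = 0 -> f = 0.
Proof.
move=> Tf f0; apply: (transf_sep HT) => E x Tx; rewrite par0l comp0l.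
apply: Tr_eq0; first by apply: TrM (Tx); exact: Tr_par (Tr1 _).
by rewrite -prb_comp -uu_effr effr_par f0 effr0l prb0l.
Qed.

(** The outcome [f] exhausts the total probability; what is left for [y] is zero on every state. *)
Lemma test_u_eq0 A B (f : V A B) (r : seq (V A B)) : Test (f :: r) ->
  uu B ∘ f = uu A -> forall y, y \in r -> y = 0.
Proof.
move=> Ht uf y yr; have := test_sum (test_map_l (uuP B) Ht).
rewrite big_map big_cons uf -[RHS]addr0 => /addrI E.
have Trr z : z \in r -> Tr z.
  by move=> zr; apply/(Tr_test HT); exists (f :: r); rewrite inE zr orbT.
apply: Tr_transf0; first exact: Trr.
apply: (effect_sep HT) => x Tx; rewrite prb0l.
have : \sum_(z <- r) prb (uu B ∘ z) x = 0.
  rewrite -(big_morph (fun g => prb g x) (fun a b => prbDl a b x) (prb0l x)).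
  by rewrite E prb0l.
move/eqP; rewrite big_seq psumr_eq0; last first.
  by move=> z /Trr Tz; apply: prb_ge0 => //; exact: TrM (Tr_uu _) Tz.
by move=> /allP /(_ _ yr); rewrite yr => /eqP.
Qed.

Lemma effl_swap_state A B C (f : V A C) (b : V B I) (S : V I (A ⊗ B)) :
  effl b f ∘ (swap T A B ∘ S) = effr f b ∘ S.
Proof.
(* Only states are considered because the hexagon axiom is not assumed: the
   automorphism [th] of [C] compares the swap with [I] to the unit
   isomorphisms, and naturality makes it act trivially on states. *)
pose th := fun D : Sys => iota (tensI_l T D) ∘ swap T D I ∘ iota (esym (tensI_r T D)).
have thI : th I = 1_I.
  rewrite -uuI; apply: uu_uniq.
  exact: chanM (chanM (chan_iota _) (swap_chan _ _)) (chan_iota _).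
have th_nat (x : V I C) : th C ∘ x = x.
  rewrite /th -compA (_ : iota _ ∘ x = par x 1_I ∘ iota (esym (tensI_r T I))); last first.
    by apply/esym; rewrite -/(insr x 1_I) -[x in LHS]comp1l -insr_comp /insr par11 comp1l.
  rewrite -compA (compA (swap T C I)) (swap_nat HT) -compA compA.
  by rewrite (unitl_nat x (tensI_l T C) (tensI_l T I)) -!compA (compA (iota _)) -/(th I) thI comp1r.
rewrite /effl -!compA (compA (par b f)) -(swap_nat HT).
rewrite -[RHS]th_nat /th /effr -!compA; congr (_ ∘ _); congr (_ ∘ _).
by rewrite !compA iotaK comp1l.
Qed.

Lemma sharp_norm A (a : V A I) (x : V I A) : Tr a -> Tr x -> prb a x = 1 ->
  norm_state x.
Proof.
move=> Ta Tx ax; apply/norm_stateE; split => //; apply/eqP.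
by rewrite eq_le (prb_le1 (Tr_uu A) Tx) /= -[X in X <= _]ax prb_leu.
Qed.

Lemma norm_exists A : exists x : V I A, norm_state x.
Proof.
have [a [pa [x [Tx ax]]]] := pure_sharpness HS A.
by exists x; exact: sharp_norm (pure_Tr pa) Tx ax.
Qed.

(** * Purity of the identity *)

(** Discarding the environment leaves the pure state [S], so the joint output is a product of [S]
    with an environment state, and [e] only contributes a scalar. *)
Lemma no_info_pure A B E (C : V A (A ⊗ E)) (e : V E I) (S : V I (B ⊗ A)) :
  channel C -> effr 1_A (uu E) ∘ C = 1_A -> pure S -> norm_state S ->
  exists p, par 1_B (effr 1_A e ∘ C) ∘ S = p *: S.
Proof.
move=> cC mC pS nS; pose Q := iota (tensA T B A E) ∘ (par 1_B C ∘ S).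
have key (b : V E I) : effr 1_(B ⊗ A) b ∘ Q = par 1_B (effr 1_A b ∘ C) ∘ S.
  rewrite -par11 -(effr_par1 _ _ _ (esym (tensA T B A E))) /Q -compA.
  by rewrite (compA (iota _)) iotaK comp1l compA parM comp1l.
have nQ : norm_state Q.
  apply: norm_chan_comp (chan_iota _) _; apply: norm_chan_comp nS.
  exact: chan_par (chan1 _) cC.
have mQ : effr 1_(B ⊗ A) (uu E) ∘ Q = S by rewrite key mC par11 comp1l.
have [|y ny EQ] := product_state nQ; first by rewrite mQ.
exists (prb e y); rewrite -key EQ effr_insr mQ comp1l.
by [].
Qed.

(** Purifying extends the scalar action from pure bipartite states to all normalized ones ([K2]).
    The scalar is then shown not to depend on the state ([K4], [K5]), and subnormalized states are
    reached by dilation. *)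
Lemma no_info A E (C : V A (A ⊗ E)) (e : V E I) :
  channel C -> effr 1_A (uu E) ∘ C = 1_A -> Tr e ->
  exists2 p, 0 <= p & effr 1_A e ∘ C = p *: 1_A.
Proof.
move=> cC mC Te; set D := effr 1_A e ∘ C.
have TD : Tr D := TrM (Tr_effr (Tr1 _) Te) (Tr_chan cC).
have K2 B (x : V I (B ⊗ A)) : norm_state x -> exists p, par 1_B D ∘ x = p *: x.
  move=> nx; have [Z [P [pP nP mP]]] := purify nx.
  pose P' := iota (tensA T Z B A) ∘ (swap T _ Z ∘ P).
  have [||p Ep] := no_info_pure e cC mC (S := P').
  - exact: pure_rev_l (rev_iota _) (pure_rev_l (swap_rev HT _ _) pP).
  - exact: norm_chan_comp (chan_iota _) (norm_chan_comp (swap_chan _ _) nP).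
  exists p; have Ex : x = par (effl (uu Z) 1_B) 1_A ∘ P'.
    rewrite -(effl_par1 _ _ _ (esym (tensA T Z B A))) /P' -compA (compA (iota _)).
    by rewrite iotaK comp1l par11 effl_swap_state mP.
  rewrite Ex compA parM comp1l comp1r -[effl _ _]comp1r -[D]comp1l -parM -compA.
  by rewrite Ep compZr comp1r.
have K3 (x : V I A) : norm_state x -> exists p, D ∘ x = p *: x.
  move=> nx; have [p Ep] := K2 A (insr x x) (norm_insr nx nx).
  exists p; move: Ep => /(congr1 (fun z => effl (uu A) 1_A ∘ z)).
  rewrite insr_insl par_insl comp1l compZr !effl_insl norm_u// !scale1r !comp1l.
  by [].
(* The midpoint of [x] and [y] is also scaled, by some [r]. Comparing deterministic probabilities
   gives [p - r = r - q], so either [p = r = q] or [x = y]. *)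
have K4 (x y : V I A) p q : norm_state x -> norm_state y ->
    D ∘ x = p *: x -> D ∘ y = q *: y -> p = q.
  move=> nx ny Ex Ey; pose z := 2^-1 *: x + (1 - 2^-1) *: y.
  have nz : norm_state z.
    apply/norm_stateE; split; last by rewrite /z prbDr !prbZr !norm_u//; lra.
    by apply: (Tr_convex HT); [exact: norm_Tr|exact: norm_Tr|lra].
  have [r] := K3 z nz; rewrite /z compDr !compZr Ex Ey => Em.
  have E1 : (p - r) *: x = (r - q) *: y.
    move: Em => /(congr1 (fun v => 2 *: v)); rewrite !scalerDr !scalerA.
    have -> : 2 * 2^-1 * p = p by lra.
    have -> : 2 * (1 - 2^-1) * q = q by lra.
    have -> : 2 * r * 2^-1 = r by lra.
    have -> : 2 * r * (1 - 2^-1) = r by lra.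
    move=> E2; apply/eqP; rewrite !scalerBl subr_eq addrAC eq_sym subr_eq.
    by rewrite addrC E2.
  have /(congr1 (prb (uu A))) := E1; rewrite !prbZr !norm_u// !mulr1 => E2.
  move: E1; rewrite -E2 => /eqP; rewrite -subr_eq0 -scalerBr scaler_eq0.
  case/orP => [/eqP pr|]; first by lra.
  rewrite subr_eq0 => /eqP xy; apply/eqP; rewrite -subr_eq0.
  have : (p - q) *: x == 0 by rewrite scalerBl -Ex xy Ey subrr.
  by rewrite scaler_eq0 (negbTE (norm_neq0 nx)) orbF.
have [x0 nx0] := norm_exists A; have [p Ep] := K3 _ nx0.
have K5 B (x : V I (B ⊗ A)) : norm_state x -> par 1_B D ∘ x = p *: x.
  move=> nx; have [q Eq] := K2 B x nx; rewrite Eq.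
  congr (_ *: _); apply: (K4 (effl (uu B) 1_A ∘ x) x0) Ep => //.
    exact: norm_chan_comp (chan_effl _ (chan1 _)) nx.
  by rewrite compA comp_effl comp1r -[uu B]comp1r -[D]comp1l -effl_par -compA Eq compZr comp1r.
exists p.
  have <- : prb (uu A) (D ∘ x0) = p by rewrite Ep prbZr norm_u// mulr1.
  by apply: prb_ge0 (Tr_uu _) _; exact: TrM TD (norm_Tr nx0).
apply: (transf_sep HT) => F x Tx; rewrite parZl compZl par11 comp1l.
have [E2 [S [e2 [nS Te2 ->]]]] := state_dilation Tx.
pose S' := iota (esym (tensA T A F E2)) ∘ S.
have nS' : norm_state S' := norm_chan_comp (chan_iota _) nS.
have ES' : par D 1_(F ⊗ E2) ∘ S' = p *: S'.
  have := K5 _ _ (norm_chan_comp (swap_chan A (F ⊗ E2)) nS').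
  rewrite compA -(swap_nat HT) -compA => /(congr1 (fun z => swap T _ _ ∘ z)).
  by rewrite compZr !compA (swap_inv HT) !comp1l.
have -> : effr 1_(A ⊗ F) e2 ∘ S = par 1_A (effr 1_F e2) ∘ S'.
  by rewrite -par11 -(effr_par1 _ _ _ (esym (tensA T A F E2))) -compA.
rewrite compA parM comp1l comp1r -[in LHS](comp1l D) -[effr 1_F e2]comp1r -parM -compA.
by rewrite ES' compZr comp1r.
Qed.

(** In a test refining the identity the unselected outcomes vanish, so the test as a whole does not
    disturb the system. Its realization then extracts no information, and each outcome is a multiple
    of the identity. *)
Lemma pure1 A : pure 1_A.
Proof.
split; first exact: Tr1.
move=> s m Hs E1 d dm.
have [r Er] := perm_to_subseq (mask_subseq m s).
have Ht : Test (1_A :: r).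
  by rewrite E1; apply: (test_coarse HT); exact: (test_perm HT Hs Er).
have r0 := test_u_eq0 Ht (comp1r _).
have [E [C [es [cC [tes Es]]]]] := test_realize HT Hs.
have Es' : s = [seq effr 1_A e ∘ C | e <- es].
  by rewrite Es; apply: eq_map => e; rewrite castVE iota1 comp1r compA.
have mC : effr 1_A (uu E) ∘ C = 1_A.
  rewrite -(test_sum tes) (big_morph (effr 1_A) (effrDr _) (effr0r _ _)).
  rewrite (big_morph (fun g => g ∘ C) (fun x y => compDl x y C) (comp0l _ _)).
  rewrite -(big_map (fun e => effr 1_A e ∘ C) predT id) -Es' (perm_big _ Er) big_cat /=.
  by rewrite -E1 big_seq big1 ?addr0.
have : d \in s by exact: mem_mask dm.
rewrite Es' => /mapP [e ees ->].
have [|p p0 Ep] := no_info cC mC (e := e); first by apply/(Tr_test HT); exists es.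
by exists p.
Qed.

(** A refinement of [y] becomes one of the product after adjoining [x]; discarding [x] brings the
    proportionality back. *)
Lemma pure_insr_r A B (x : V I A) (y : V I B) :
  norm_state x -> Tr y -> pure (insr x y) -> pure y.
Proof.
move=> nx Ty [_ Pxy]; split => // s m Hs E d dm.
have Ei (f : V I B) : insr x f = insl x 1_B ∘ f by rewrite insr_insl insl_comp comp1l.
have [||p [p0]] := Pxy _ m (test_map_l (chan_insl B nx) Hs) _ (insl x 1_B ∘ d).
- by rewrite -map_mask big_map -comp_sumr -E Ei.
- by rewrite -map_mask map_f.
move=> /(congr1 (fun z => effl (uu A) 1_B ∘ z)).
rewrite -Ei compZr !insr_insl !effl_insl norm_u// !scale1r !comp1l => Ed.
by exists p.
Qed.

Lemma effr_swap_state A B C (f : V B C) (b : V A I) (S : V I (A ⊗ B)) :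
  effr f b ∘ (swap T A B ∘ S) = effl b f ∘ S.
Proof.
by rewrite -(effl_swap_state f b (swap T A B ∘ S)) (compA (swap T B A)) (swap_inv HT) comp1l.
Qed.

Lemma effl_marg A B (a : V A I) (S : V I (A ⊗ B)) :
  prb (uu B) (effl a 1_B ∘ S) = prb a (effr 1_A (uu B) ∘ S).
Proof. by rewrite -!prb_comp comp_effl comp1r comp_effr comp1r effr_effl. Qed.

Lemma pure_effl A B (a : V A I) : pure a -> pure (effl a 1_B).
Proof.
move=> pa; apply: pure_rev_l (rev_iota _) _.
by apply: (purity_pres_par HS) => //; exact: pure1.
Qed.

(** * Sharp effects *)

(** On a purification of [x], the effects [a] and [uu A] steer the same state of the purifying
    system. The steering by [a] is pure, so that marginal is pure, the purification is a product,
    and its factor [x] is pure. *)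
Lemma sharp_pure A (a : V A I) (x : V I A) :
  pure a -> norm_state x -> prb a x = 1 -> pure x.
Proof.
move=> pa nx ax; have [B [P [pP nP mP]]] := purify nx.
have E : effl (uu A) 1_B ∘ P = effl a 1_B ∘ P.
  apply/eqP; rewrite -subr_eq0; apply/eqP.
  have -> : effl (uu A) 1_B ∘ P - effl a 1_B ∘ P = effl (uu A - a) 1_B ∘ P.
    by rewrite /effl -[- (_ ∘ P)]scaleN1r -compZl -compZr -parZl -!compDl -compDr -parDl scaleN1r.
  apply: Tr_eq0; last by rewrite effl_marg mP prbBl ax norm_u// subrr.
  by apply: TrM (norm_Tr nP); apply: Tr_effl (Tr1 _) _; exact/Tr_compl/pure_Tr.
pose S := swap T A B ∘ P.
have pS : pure S := pure_rev_l (swap_rev HT _ _) pP.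
have nS : norm_state S := norm_chan_comp (swap_chan _ _) nP.
have [|y ny ES] := product_state nS.
  rewrite effr_swap_state E; apply: (purity_pres_seq HS) => //.
  exact: pure_effl.
have -> : x = y.
  rewrite -mP -(effl_swap_state 1_A (uu B) P) -/S ES insr_insl effl_insl comp1l.
  by rewrite norm_u ?scale1r//; exact: norm_chan_comp (chan_effr _ (chan1 _)) nS.
apply: (pure_insr_r (x := effr 1_B (uu A) ∘ S)) (norm_Tr ny) _; last by rewrite -ES.
exact: norm_chan_comp (chan_effr _ (chan1 _)) nS.
Qed.

Lemma prb11 : prb 1_I 1_I = 1 :> R.
Proof. by rewrite /prb comp1l (scal_id HT). Qed.

(** Both states purify the unique normalized state of the trivial system. *)
Lemma pure_transitive A (x y : V I A) : pure x -> norm_state x ->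
  pure y -> norm_state y -> exists2 U : V A A, reversible U & y = U ∘ x.
Proof.
move=> px nx py ny; have n1 : norm_state 1_I := chan_norm (chan1 I).
have [|||||U rU E] := purif_rev (P := insr 1_I x) (Q := insr 1_I y).
- exact: pure_insr (pure1 _) px.
- exact: norm_insr.
- exact: pure_insr (pure1 _) py.
- exact: norm_insr.
- by rewrite !effr_insr !norm_u.
exists U => //; move: E => /(congr1 (fun z => effl 1_I 1_A ∘ z)).
by rewrite par_insr comp1l !insr_insl !effl_insl prb11 !scale1r !comp1l.
Qed.

(** Pure Sharpness provides one sharp pair; a reversible channel carries it to [x]. *)
Lemma sharp_effect A (x : V I A) : pure x -> norm_state x ->
  exists2 a : V A I, pure a & prb a x = 1.
Proof.
move=> px nx; have [a [pa [y [Ty ay]]]] := pure_sharpness HS A.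
have ny : norm_state y := sharp_norm (pure_Tr pa) Ty ay.
have [U rU Ey] := pure_transitive px nx (sharp_pure pa ny ay) ny.
by exists (a ∘ U); [exact: pure_rev_r|rewrite prb_comp -Ey].
Qed.

Definition mid A B (x y : V A B) : V A B := 2^-1 *: (x + y).
Lemma Tr_mid A B (x y : V A B) : Tr x -> Tr y -> Tr (mid x y).
Proof.
move=> Tx Ty; rewrite /mid scalerDr.
have -> : 2^-1 *: y = (1 - 2^-1) *: y by congr (_ *: _); lra.
by apply: (Tr_convex HT) => //; lra.
Qed.

Lemma comp_midr A B C (g : V B C) (x y : V A B) : g ∘ mid x y = mid (g ∘ x) (g ∘ y).
Proof. by rewrite /mid compZr compDr. Qed.

Lemma comp_midl A B C (g : V A B) (x y : V B C) : mid x y ∘ g = mid (x ∘ g) (y ∘ g).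
Proof. by rewrite /mid compZl compDl. Qed.

Lemma midxx A B (x : V A B) : mid x x = x.
Proof.
rewrite /mid scalerDr -scalerDl (_ : 2^-1 + 2^-1 = 1) ?scale1r//; lra.
Qed.

Lemma prb_midr A (a : V A I) (x y : V I A) :
  prb a (mid x y) = 2^-1 * (prb a x + prb a y).
Proof. by rewrite /mid prbZr prbDr. Qed.

Lemma norm_mid A (x y : V I A) : norm_state x -> norm_state y -> norm_state (mid x y).
Proof.
move=> nx ny; apply/norm_stateE; split; first exact: Tr_mid (norm_Tr nx) (norm_Tr ny).
by rewrite prb_midr !norm_u//; lra.
Qed.

Lemma state_neq A (x y : V I A) : x <> y ->
  exists2 a : V A I, Tr a & prb a x <> prb a y.
Proof.
move=> xy; apply: contrapT => H; apply: xy; apply: (state_sep HT) => a Ta.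
by apply: contrapT => axy; apply: H; exists a.
Qed.

Lemma effect_neq A (a b : V A I) : a <> b ->
  exists2 x : V I A, Tr x & prb a x <> prb b x.
Proof.
move=> ab; apply: contrapT => H; apply: ab; apply: (effect_sep HT) => x Tx.
by apply: contrapT => abx; apply: H; exists x.
Qed.

(** Subtracting the two mixtures leaves [(t - t') / 4] times [x - y]. *)
Lemma wmid_prop A B (x y : V A B) (t t' p : R) :
  t <> t' -> mid (t *: x) (t' *: y) = p *: mid x y -> 2^-1 * (t + t') = p -> x = y.
Proof.
move=> tt' E pE; apply/eqP; rewrite -subr_eq0.
have : 4^-1 * (t - t') *: (x - y) = 0.
  have -> : 4^-1 * (t - t') *: (x - y) = mid (t *: x) (t' *: y) - p *: mid x y.
    rewrite -pE /mid !scalerDr !scalerA scalerN -scaleNr opprD addrACA -!scalerBl.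
    by congr (_ *: _ + _ *: _); lra.
  by rewrite E subrr.
move/eqP; rewrite scaler_eq0 mulf_eq0 invr_eq0 pnatr_eq0 /= subr_eq0.
by case/orP => [|//]; rewrite subr_eq0 => /eqP /tt' [].
Qed.

Lemma sharp_state_unique A (a : V A I) (x y : V I A) : pure a ->
  norm_state x -> norm_state y -> prb a x = 1 -> prb a y = 1 -> x = y.
Proof.
move=> pa nx ny ax ay; apply: contrapT => xy.
have [e Te exy] := state_neq xy; pose z := mid x y.
have nz : norm_state z := norm_mid nx ny.
have pz : pure z by apply: (sharp_pure pa) => //; rewrite prb_midr ax ay; lra.
(* The classical correlation of [x] and [y] with themselves has the pure
   marginal [z], hence is a product, although [e] separates [x] from [y]. *)
pose L := mid (insr x x) (insr y y).
have nL : norm_state L by apply: norm_mid; exact: norm_insr.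
have mL : effr 1_A (uu A) ∘ L = z.
  by rewrite comp_midr !effr_insr !norm_u// !scale1r !comp1l.
have [|w nw EL] := product_state nL; first by rewrite mL.
have E : mid (prb e x *: x) (prb e y *: y) = prb e w *: z.
  have := congr1 (fun v => effr 1_A e ∘ v) EL.
  by rewrite mL comp_midr !effr_insr !comp1l.
apply: xy; apply: (wmid_prop exy E).
have := congr1 (prb (uu A)) E; rewrite [in RHS]prbZr (norm_u nz) prb_midr !prbZr (norm_u nx) (norm_u ny) !mulr1.
by [].
Qed.

Lemma prb_sumr A (a : V A I) (n : nat) (F : 'I_n -> V I A) :
  prb a (\sum_i F i) = \sum_i prb a (F i).
Proof. exact: (big_morph _ (prbDr a) (prb0r a)). Qed.

(** In coordinates the effect is a continuous function on a compact set, so its supremum is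
    attained. Compactness concerns all states; normalization of the maximizer follows from its
    probability being 1. *)
Lemma norm_effect_attained A (a : V A I) : norm_effect a ->
  exists2 x : V I A, norm_state x & prb a x = 1.
Proof.
move=> [Ta [_ sup1]].
pose W := V I A; pose n := \dim (fullv : {vspace W}).
pose b := fun i : 'I_n => (vbasis (fullv : {vspace W}))`_i.
pose F (r : 'rV[R]_n) : R := \sum_(i < n) r 0 i * prb a (b i).
have FE (x : W) : F (coords x) = prb a x.
  rewrite [in RHS](coord_vbasis (memvf x)) prb_sumr.
  by apply: eq_bigr => i _; rewrite prbZr /coords mxE.
have Fc : continuous F.
  apply: continuous_big => [|i _ r]; first exact: add_continuous.
  apply: (@cvgM R _ _ (nbhs_filter r)); last exact: cvg_cst.
  exact: (@coord_continuous R 1 n 0 i r).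
pose K := [set F r | r in [set coords v | v in [set f : W | Tr f]]]%classic.
have cK : closed K.
  apply: compact_closed; first exact: Rhausdorff.
  apply: continuous_compact; last exact: Tr_compact HT I A.
  exact: continuous_subspaceT.
have : K 1.
  apply: cK => B /nbhs_ballP [eps /= eps0 sB].
  have [x [nx ax]] := sup1 eps eps0.
  exists (prb a x); split; first by exists (coords x); [exists x => //; exact: norm_Tr|].
  apply: sB; rewrite /ball /= ger0_norm ?subr_ge0 ?prb_le1//; last exact: norm_Tr.
  by rewrite ltrBlDr addrC -ltrBlDr.
move=> [_ [x Tx <-]]; rewrite FE => ax; exists x => //.
exact: sharp_norm ax.
Qed.

Lemma effl_lin A B C (k : R) (y z : V B I) (f : V A C) :
  effl (k *: y + z) f = k *: effl y f + effl z f.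
Proof. by rewrite /effl parDl parZl compDr compZr. Qed.

(** * Pure states that steer every state *)

Section Faithful.
Variables (A E0 : Sys) (phi0 phi1 : V I E0).
Hypotheses (n0 : norm_state phi0) (n1 : norm_state phi1) (neq : phi0 <> phi1).

(** The vector [g] is a linear functional and need not be an effect. The value 2 cancels the weight
    1/2 of a mixture labelled by [phi0] and [phi1]. *)
Lemma coin_functional : exists g : V E0 I, prb g phi0 = 2 /\ prb g phi1 = 0.
Proof.
have [e _ ne] := state_neq neq; pose d := prb e phi0 - prb e phi1.
have d0 : d != 0 by rewrite subr_eq0; apply/eqP.
exists ((2 / d) *: (e - prb e phi1 *: uu E0)).
rewrite !prbZl !prbBl !prbZl !norm_u// !mulr1 subrr mulr0; split => //.
by rewrite -mulrA mulVf// mulr1.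
Qed.

Lemma coin_functional' : exists g : V E0 I, prb g phi0 = 0 /\ prb g phi1 = 2.
Proof.
have [g [g0 g1]] := coin_functional; exists (2 *: uu E0 - g).
by rewrite !prbBl !prbZl !norm_u// g0 g1; split; lra.
Qed.

(** The state [M] is the even mixture of [P] and [C], padded to a common steering system and flagged
    by the coin states; reading the flag recovers either one. *)
Lemma mix_reach B E (P : V I (B ⊗ A)) (C : V I (E ⊗ A)) :
  norm_state P -> norm_state C -> exists D (M : V I (D ⊗ A)),
  [/\ norm_state M,
      forall y : V B I, exists z : V D I, effl z 1_A ∘ M = effl y 1_A ∘ P &
      forall y : V E I, exists z : V D I, effl z 1_A ∘ M = effl y 1_A ∘ C].
Proof.
move=> nP nC; have [eps neps] := norm_exists E; have [bet nbet] := norm_exists B.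
pose k0 := insr (insr 1_B eps) phi0; pose k1 := insr (insl bet 1_E) phi1.
have ck0 : channel k0.
  by rewrite /k0 -[insr 1_B eps]comp1l -insr_comp; apply: chanM; exact: chan_insr.
have ck1 : channel k1.
  rewrite /k1 -[insl bet 1_E]comp1l -insr_comp; apply: chanM; first exact: chan_insr.
  exact: chan_insl.
exists (B ⊗ E ⊗ E0), (mid (par k0 1_A ∘ P) (par k1 1_A ∘ C)); split.
- by apply: norm_mid; apply: norm_chan_comp => //; apply: chan_par => //; exact: chan1.
- move=> y; have [g [g0 g1]] := coin_functional.
  exists (effr (effr y (uu E)) g); rewrite comp_midr !compA !effl_par comp1l.
  rewrite !effr_insr g0 g1 scale0r norm_u// scale1r comp1r.
  by rewrite /effl par0l comp0r comp0l /mid addr0 parZl compZr compZl scalerA mulVf ?scale1r ?pnatr_eq0.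
- move=> y; have [g [g0 g1]] := coin_functional'.
  exists (effr (effl (uu B) y) g); rewrite comp_midr !compA !effl_par comp1l.
  rewrite !effr_insr g0 g1 scale0r effl_insl norm_u// scale1r comp1r.
  by rewrite /effl par0l comp0r comp0l /mid add0r parZl compZr compZl scalerA mulVf ?scale1r ?pnatr_eq0.
Qed.

(* A state [P] whose steered vectors span a subspace of maximal dimension
   steers every state, since mixing it with a dilation of another state against
   the coin [phi0], [phi1] would otherwise enlarge the span. *)
Lemma faithful_norm : exists B (P : V I (B ⊗ A)), norm_state P /\
  forall x : V I A, Tr x -> exists y : V B I, x = effl y 1_A ∘ P.
Proof.
pose F B (P : V I (B ⊗ A)) : {linear V B I -> V I A} :=
  HB.pack (fun y : V B I => effl y 1_A ∘ P)
   (GRing.isLinear.Build R (V B I) (V I A) _ (fun y : V B I => effl y 1_A ∘ P)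
     (fun k y z => etrans (congr1 (fun g => g ∘ P) (effl_lin k y z 1_A))
        (comp_linear_l HT _ _ _ _))).
pose U B (P : V I (B ⊗ A)) := limg (linfun (F B P)).
have UP B (P : V I (B ⊗ A)) x : reflect (exists y, x = effl y 1_A ∘ P) (x \in U B P).
  apply: (iffP memv_imgP) => [[y _ ->]|[y ->]].
    by exists y; rewrite lfunE.
  by exists y; rewrite ?memvf ?lfunE.
pose Q := fun n => `[< exists B (P : V I (B ⊗ A)), norm_state P /\ \dim (U B P) = n >].
have exQ : exists n, Q n.
  have [x nx] := norm_exists A.
  by exists (\dim (U A (insr x x))); apply/asboolP; exists A, (insr x x); split=> //; exact: norm_insr.
have bQ n : Q n -> (n <= \dim {: V I A})%N.
  by move=> /asboolP [B [P [_ <-]]]; exact/dimvS/subvf.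
case: (ex_maxnP exQ bQ) => n /asboolP [B [P [nP dP]]] maxn.
exists B, P; split => // x Tx; apply/UP.
have [E [C [e [nC Te ->]]]] := state_dilation Tx.
have [D [M [nM MP MC]]] := mix_reach nP (norm_chan_comp (swap_chan A E) nC).
have sPM : (U B P <= U D M)%VS.
  by apply/subvP => v /UP [y ->]; apply/UP; have [z <-] := MP y; exists z.
have /eqP -> : U B P == U D M.
  by rewrite eqEdim sPM dP; apply: maxn; apply/asboolP; exists D, M.
by apply/UP; have [z Ez] := MC e; exists z; rewrite Ez effl_swap_state.
Qed.

(** Purifying a faithful state keeps it faithful, since the purifying system can be discarded before
    steering. *)
Lemma faithful_pure : exists B (P : V I (B ⊗ A)), [/\ pure P, norm_state P &
  forall x : V I A, Tr x -> exists y : V B I, x = effl y 1_A ∘ P].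
Proof.
have [B [P [nP fP]]] := faithful_norm.
have [Z [Q [pQ nQ mQ]]] := purify nP.
exists (Z ⊗ B), (iota (tensA T Z B A) ∘ (swap T _ Z ∘ Q)); split.
- exact: pure_rev_l (rev_iota _) (pure_rev_l (swap_rev HT _ _) pQ).
- exact: norm_chan_comp (chan_iota _) (norm_chan_comp (swap_chan _ _) nQ).
move=> x /fP [y ->]; exists (effl (uu Z) y).
rewrite -(effl_assoc _ _ _ (esym (tensA T Z B A))) -compA (compA (iota _)) iotaK comp1l.
by rewrite effl_swap_state -mQ compA comp_effr comp1r.
Qed.

End Faithful.

Lemma pure_exists A : exists2 x : V I A, pure x & norm_state x.
Proof.
have [a [pa [x [Tx ax]]]] := pure_sharpness HS A.
have nx : norm_state x := sharp_norm (pure_Tr pa) Tx ax.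
by exists x => //; exact: sharp_pure ax.
Qed.

Lemma iota_insr_state A B C (S : V I (A ⊗ B)) (y : V I C)
    (e : A ⊗ B ⊗ C = A ⊗ (B ⊗ C)) :
  iota e ∘ insr S y = par 1_A (insr 1_B y) ∘ S.
Proof.
rewrite -[S in LHS]comp1l -insr_comp compA; congr (_ ∘ _).
rewrite /insr -par11 compA -(par_assoc_r _ _ _ _ (esym (tensA T A B I))).
rewrite -compA -[1_A in RHS]comp1l -parM; congr (_ ∘ _).
by rewrite -[1_A](iota1 erefl) par_iota iotaM; exact: iota_irr.
Qed.

(** * Uniqueness of the sharp effect *)

(** The control system [F] carries the coin together with the purifying systems, and [g] measures
    [e] on the coin and discards the rest. *)
Lemma coherent_split A E0 (phi0 phi1 : V I E0) (e : V E0 I) (al : V I A) :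
  norm_state phi0 -> norm_state phi1 -> phi0 <> phi1 -> Tr e ->
  pure al -> norm_state al ->
  exists F (W : V A (A ⊗ A ⊗ F)) (g : V F I),
  [/\ pure W, channel W, Tr g,
    forall p : V (A ⊗ A) I,
      effr p (uu F) ∘ W = mid (p ∘ insr 1_A al) (p ∘ insl al 1_A) &
    forall p : V (A ⊗ A) I, effr p g ∘ W =
      mid (prb e phi0 *: (p ∘ insr 1_A al)) (prb e phi1 *: (p ∘ insl al 1_A))].
Proof.
move=> n0 n1 neq Te pal nal.
have [B [P [pP nP fP]]] := faithful_pure A n0 n1 neq.
(* As [P] steers every state, a functional on [A] is determined by its action on [P]. *)
have faithful (q q' : V A I) : effr 1_B q ∘ P = effr 1_B q' ∘ P -> q = q'.
  move=> E; apply: (effect_sep HT) => x /fP [y ->].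
  have H (r : V A I) : prb r (effl y 1_A ∘ P) = prb y (effr 1_B r ∘ P).
    by rewrite -!prb_comp comp_effl comp_effr !comp1r effr_effl.
  by rewrite !H E.
pose X := A ⊗ A.
pose V0 := insr (insr 1_A al) phi0; pose V1 := insr (insl al 1_A) phi1.
have cV0 : channel V0.
  by rewrite /V0 -[insr 1_A al]comp1l -insr_comp; apply: chanM; exact: chan_insr.
have cV1 : channel V1.
  rewrite /V1 -[insl al 1_A]comp1l -insr_comp; apply: chanM; first exact: chan_insr.
  exact: chan_insl.
pose VV := mid V0 V1.
(* Convexity yields a transformation; normalization of its outputs comes from [uV]. *)
have TV : Tr VV := Tr_mid (Tr_chan cV0) (Tr_chan cV1).
have uV : uu (X ⊗ E0) ∘ VV = uu A by rewrite comp_midr !uu_chan// midxx.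
pose L := par 1_B VV ∘ P.
have nL : norm_state L.
  apply: norm_comp nP; first exact: Tr_par (Tr1 _) TV.
  by rewrite -[LHS](congr1 (fun u => u ∘ _) (uu_effr _ _)) effr_par comp1r uV uu_effr.
have [G [Q0 [pQ0 nQ0 mQ0]]] := purify nL.
pose Y := X ⊗ E0 ⊗ G.
pose Q := iota (esym (tensA T B (X ⊗ E0) G)) ∘ Q0.
have pQ : pure Q := pure_rev_l (rev_iota _) pQ0.
have nQ : norm_state Q := norm_chan_comp (chan_iota _) nQ0.
have mQ (y : V (X ⊗ E0) I) : effr 1_B (effr y (uu G)) ∘ Q = effr 1_B (y ∘ VV) ∘ P.
  rewrite /Q compA effr_assoc -[effr 1_B y]comp1r -comp_effr -compA mQ0 /L compA.
  by rewrite effr_par comp1l.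
have [dl pdl ndl] := pure_exists Y.
(* Padding with [dl] and [al] gives [P] and [Q] the same purifying system over [B], and [U] then
   implements [VV] reversibly on the faithful state. *)
pose P1 := iota (esym (tensA T B A Y)) ∘ insr P dl.
pose P2 := iota (esym (tensA T B Y A)) ∘ insr Q al.
pose P3 := par 1_B (swap T Y A) ∘ P2.
have mP2 (y : V Y I) : effr 1_B (effr y (uu A)) ∘ P2 = effr 1_B y ∘ Q.
  by rewrite /P2 compA effr_assoc effr_insr norm_u// scale1r.
have pP2 : pure P2 := pure_rev_l (rev_iota _) (pure_insr pQ pal).
have nP2 : norm_state P2 := norm_chan_comp (chan_iota _) (norm_insr nQ nal).
have [|||||U rU EU] := purif_rev (P := P1) (Q := P3).
- exact: pure_rev_l (rev_iota _) (pure_insr pP pdl).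
- exact: norm_chan_comp (chan_iota _) (norm_insr nP ndl).
- exact: pure_rev_l (rev_par (rev1 _) (swap_rev HT _ _)) pP2.
- exact: norm_chan_comp (chan_par (chan1 _) (swap_chan _ _)) nP2.
- rewrite -[in LHS]uu_effr /P1 compA effr_assoc effr_insr norm_u// scale1r.
  rewrite /P3 compA effr_par comp1l uu_chan; last exact: swap_chan.
  by rewrite -uu_effr mP2 -uu_effr mQ uV.
pose W0 := swap T A Y ∘ (U ∘ insr 1_A dl).
have EW0 : par 1_B W0 ∘ P = P2.
  have -> : P2 = par 1_B (swap T A Y) ∘ P3.
    by rewrite /P3 compA parM comp1l (swap_inv HT) par11 comp1l.
  rewrite EU /P1 iota_insr_state /W0 (compA (swap T A Y) U).
  by rewrite (compA _ (par 1_B U)) parM (compA _ (par 1_B _) P) parM !comp1l.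
have eY : Y ⊗ A = X ⊗ (E0 ⊗ (G ⊗ A)) by rewrite /Y -!tensA.
have key (p : V X I) (y : V E0 I) :
    effr p (effr y (uu (G ⊗ A))) ∘ (iota eY ∘ W0) = effr p y ∘ VV.
  apply: faithful; rewrite -mQ -mP2 -EW0 (compA (effr 1_B _)) effr_par comp1l.
  congr (effr _ _ ∘ _); rewrite compA; congr (_ ∘ _).
  rewrite -(effr_assoc _ _ _ (esym (tensA T (X ⊗ E0) G A))) uu_effr.
  rewrite -(effr_assoc _ _ _ (esym (tensA T X E0 (G ⊗ A)))) -compA iotaM.
  by congr (_ ∘ _); exact: iota_irr.
have cU : channel U by case: rU.
exists (E0 ⊗ (G ⊗ A)), (iota eY ∘ W0), (effr e (uu (G ⊗ A))); split.
- apply: pure_rev_l (rev_iota _) _; apply: pure_rev_l (swap_rev HT _ _) _.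
  apply: pure_rev_l rU _; apply: pure_rev_r (rev_iota _) _.
  by apply: (purity_pres_par HS) => //; exact: pure1.
- apply: chanM (chan_iota _) _; apply: chanM (swap_chan _ _) _.
  by apply: chanM cU _; exact: chan_insr.
- exact: Tr_effr Te (Tr_uu _).
- move=> p; rewrite -uu_effr key comp_midr !effr_insr !norm_u// !scale1r.
  by [].
- by move=> p; rewrite key comp_midr !effr_insr.
Qed.

(** Finite sums of effects. Differences of effects will be shown to be nonnegative in this form,
    without being effects themselves. *)
Inductive conic A : V A I -> Prop :=
| conic_Tr a : Tr a -> conic a
| conicD a b : conic a -> conic b -> conic (a + b).

Lemma conic_ge0 A (a : V A I) x : conic a -> Tr x -> 0 <= prb a x.
Proof.
move=> ca Tx; elim: ca => [b Tb|b c _ b0 _ c0]; first exact: prb_ge0.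
by rewrite prbDl addr_ge0.
Qed.

Lemma effrDl A B C (f f' : V A C) (b : V B I) : effr (f + f') b = effr f b + effr f' b.
Proof. by rewrite /effr parDl compDr. Qed.

Lemma pure_effr A B C (f : V A C) (b : V B I) : pure f -> pure b -> pure (effr f b).
Proof.
by move=> pf pb; apply: pure_rev_l (rev_iota _) _; exact: (purity_pres_par HS).
Qed.

Section Uniqueness.
Variables (A F : Sys) (W : V A (A ⊗ A ⊗ F)) (g : V F I) (al : V I A) (t0 t1 : R).
Hypotheses (pal : pure al) (nal : norm_state al) (pW : pure W) (cW : channel W).
Hypotheses (Tg : Tr g) (t01 : t0 <> t1).
Hypothesis Wu : forall p : V (A ⊗ A) I,
  effr p (uu F) ∘ W = mid (p ∘ insr 1_A al) (p ∘ insl al 1_A).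
Hypothesis Wg : forall p : V (A ⊗ A) I,
  effr p g ∘ W = mid (t0 *: (p ∘ insr 1_A al)) (t1 *: (p ∘ insl al 1_A)).

(** The recombination of [a] and [b]: each reads one output copy of [A], and [y] reads the
    control. *)
Definition Hop (a b : V A I) (y : V F I) : V A I := effr (effr a b) y ∘ W.

Lemma HopDl a a' b y : Hop (a + a') b y = Hop a b y + Hop a' b y.
Proof. by rewrite /Hop !effrDl compDl. Qed.

Lemma HopDr a b b' y : Hop a (b + b') y = Hop a b y + Hop a b' y.
Proof. by rewrite /Hop effrDr effrDl compDl. Qed.

Lemma HopDy a b y y' : Hop a b (y + y') = Hop a b y + Hop a b y'.
Proof. by rewrite /Hop effrDr compDl. Qed.

Lemma HopB a b c d y :
  Hop a b y - Hop c d y = Hop (a - c) b y + Hop c (b - d) y.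
Proof. by apply/eqP; rewrite subr_eq -addrA -HopDr subrK -HopDl subrK. Qed.

Lemma Hop_Tr a b y : Tr a -> Tr b -> Tr y -> Tr (Hop a b y).
Proof. by move=> Ta Tb Ty; apply: TrM (Tr_chan cW); do 2 apply: Tr_effr => //. Qed.

Lemma Hop_conic a b y : conic a -> conic b -> Tr y -> conic (Hop a b y).
Proof.
move=> ca cb Ty; elim: ca => [c Tc|c d _ Hc _ Hd]; last by rewrite HopDl; exact: conicD.
elim: cb => [d Td|d e _ Hd _ He]; last by rewrite HopDr; exact: conicD.
by apply: conic_Tr; exact: Hop_Tr.
Qed.

Lemma Hop_pure a b y : pure a -> pure b -> pure y -> pure (Hop a b y).
Proof.
move=> pa pb py; apply: (purity_pres_seq HS) => //.
by do 2 apply: pure_effr => //.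
Qed.

Lemma effr_ins_r (a b : V A I) : effr a b ∘ insr 1_A al = prb b al *: a.
Proof. by rewrite effr_insr comp1r. Qed.

Lemma effr_ins_l (a b : V A I) : effr a b ∘ insl al 1_A = prb a al *: b.
Proof. by rewrite effr_effl effl_insl comp1r. Qed.

Lemma Hop_u a b : Hop a b (uu F) = mid (prb b al *: a) (prb a al *: b).
Proof. by rewrite /Hop Wu effr_ins_r effr_ins_l. Qed.

Lemma Hop_g a b : Hop a b g = mid (t0 *: (prb b al *: a)) (t1 *: (prb a al *: b)).
Proof. by rewrite /Hop Wg effr_ins_r effr_ins_l. Qed.

(** Both control outcomes occur in one test, so purity of their sum constrains each of them. *)
Lemma Hop_test a b y : Tr a -> Tr b -> Tr y ->
  exists r, Test [:: Hop a b y, Hop a b (uu F - y) & r].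
Proof.
move=> /test_compl ta /test_compl tb /test_compl ty.
have := test_map_l (chan_iota (tensI_r T I)) (test_par HT ta tb).
move=> /(fun t => test_par HT t ty) /(test_map_l (chan_iota (tensI_r T I))).
by move=> /(test_map_r cW) t; eexists; exact: t.
Qed.

(** Both branches send [al] to the same pure product, so the control is uncorrelated with the
    output. *)
Lemma W_al : exists f : V I F, [/\ pure f, norm_state f & W ∘ al = insr (insr al al) f].
Proof.
have nS : norm_state (W ∘ al) := norm_chan_comp cW nal.
have pS : pure (W ∘ al) := purity_pres_seq HS pal pW.
have mS : effr 1_(A ⊗ A) (uu F) ∘ (W ∘ al) = insr al al.
  apply: (state_sep HT) => p _.
  rewrite -prb_comp comp_effr comp1r -prb_comp Wu /prb comp_midl -!(compA p).
  by rewrite insr_comp insl_comp !comp1l -insr_insl midxx.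
have [|f nf Ef] := product_state nS; first by rewrite mS; exact: pure_insr.
exists f; split => //; last by rewrite Ef mS.
apply: (pure_insr_r (x := insr al al)) (norm_Tr nf) _; first exact: norm_insr.
by rewrite -mS -Ef.
Qed.

(* Recombining two effects [a] and [a'] that are sharp on [al] coherently,
   i.e. conditioning on an effect [h] that is sharp on the control state, loses
   at most [H k - H k.+1], where [H] iterates the recombination from [uu A].
   The losses telescope to at most [1], so recombining [a'] and [a] loses
   nothing: their incoherent mixture is pure, although [g] refines it. *)
Lemma sharp_effect_eq a a' : pure a -> pure a' ->
  prb a al = 1 -> prb a' al = 1 -> a' = a.
Proof.
move=> pa pa' a1 a'1.
have [f [pf nf Ef]] := W_al; have [h ph hf] := sharp_effect pf nf.
have Th : Tr h := pure_Tr ph; have Ta := pure_Tr pa; have Ta' := pure_Tr pa'.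
have Hal b c y : prb (Hop b c y) al = prb b al * prb c al * prb y f.
  rewrite /Hop /prb -compA Ef effr_insr scalZ.
  by rewrite effr_insr scalZ /prb; ring.
(* [Hop b b h] refines the pure effect [Hop b b (uu F) = b], hence is a multiple of [b]; evaluation
   at [al] gives the factor 1. *)
have fixh b : pure b -> prb b al = 1 -> Hop b b h = b.
  move=> pb b1; have [r Ht] := Hop_test (pure_Tr pb) (pure_Tr pb) Th.
  have [|p p0 Ep] := pure_split pb Ht.
    by rewrite -HopDy addrC subrK Hop_u b1 !scale1r midxx.
  have := congr1 (fun z => prb z al) Ep; rewrite Hal prbZl b1 hf !mulr1 => p1.
  by rewrite Ep -p1 scale1r.
pose H k := iter k (fun e => Hop e e h) (uu A).
have HS1 k : H k.+1 = Hop (H k) (H k) h by [].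
(* Since [a] and [a'] are fixed points and [Hop] is monotone in both slots, the iterates stay above
   them. *)
have Hk k : [/\ conic (H k), prb (H k) al = 1, conic (H k - a) & conic (H k - a')].
  elim: k => [|k [c1 H1 ca ca']].
    split; [exact/conic_Tr/Tr_uu|exact: norm_u|exact/conic_Tr/Tr_compl|exact/conic_Tr/Tr_compl].
  rewrite HS1; split; first exact: Hop_conic.
  - by rewrite Hal H1 hf !mulr1.
  - rewrite -[X in _ - X](fixh a)// HopB.
    by apply: conicD; apply: Hop_conic => //; exact: conic_Tr.
  - rewrite -[X in _ - X](fixh a')// HopB.
    by apply: conicD; apply: Hop_conic => //; exact: conic_Tr.
pose l := Hop a' a (uu F - h).
have Tl : Tr l := Hop_Tr Ta' Ta (Tr_compl Th).
(* The decrement is [Hop (H k) (H k) (uu F - h)], which dominates [l] because [H k] dominates [a']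
   and [a]. *)
have step k x : Tr x -> prb l x <= prb (H k) x - prb (H k.+1) x.
  move=> Tx; have [c1 H1 ca ca'] := Hk k; rewrite -subr_ge0 -!prbBl.
  apply: conic_ge0 => //.
  have -> : H k - H k.+1 = Hop (H k) (H k) (uu F - h).
    apply/eqP; rewrite subr_eq HS1 -HopDy subrK Hop_u H1 !scale1r midxx.
    by [].
  rewrite HopB; apply: conicD; apply: Hop_conic => //; try exact: Tr_compl.
  exact: conic_Tr.
have l0 : l = 0.
  apply: (effect_sep HT) => x Tx; rewrite prb0l; apply/eqP; rewrite eq_le prb_ge0 // andbT.
  (* Summing [k] decrements telescopes to at most [prb (uu A) x], so a positive [prb l x] would
     contradict the Archimedean property. *)
  have sum k : k%:R * prb l x <= 1.
    apply: (@le_trans _ _ (prb (H 0) x - prb (H k) x)).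
      elim: k => [|k IH]; first by rewrite mul0r subrr.
      by rewrite -natr1 mulrDl mul1r; have := step k x Tx; lra.
    have [c1 _ _ _] := Hk k; have := conic_ge0 c1 Tx.
    by have := prb_le1 (Tr_uu A) Tx; rewrite /H /=; lra.
  rewrite leNgt; apply/negP => l_gt0.
  have := archi_boundP (ltW (_ : 0 < (prb l x)^-1)); rewrite invr_gt0 => /(_ l_gt0).
  by rewrite -(ltr_pM2r l_gt0) mulVf ?gt_eqF// ltNge sum.
have pm : pure (mid a' a).
  have -> : mid a' a = Hop a' a h.
    have := Hop_u a' a; rewrite a1 a'1 !scale1r => <-.
    by rewrite -[Hop a' a h]addr0 -l0 /l -HopDy addrC subrK.
  exact: Hop_pure.
(* Conditioning on [g] refines the pure mixture with unequal weights [t0] and [t1], which forces its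
   components to coincide. *)
have [r Ht] := Hop_test Ta' Ta Tg.
have [|p p0] := pure_split pm Ht.
  by rewrite -HopDy addrC subrK Hop_u a1 a'1 !scale1r.
rewrite Hop_g a1 a'1 !scale1r => E; apply: (wmid_prop t01 E).
have := congr1 (fun z => prb z al) E; rewrite /mid !prbZl !prbDl !prbZl a1 a'1.
by lra.
Qed.

End Uniqueness.

(** If [a] and [a'] differed, their disagreement would itself supply the two distinguishable coin
    states that [coherent_split] requires. *)
Lemma sharp_effect_unique A (a a' : V A I) (al : V I A) : pure a -> pure a' ->
  pure al -> norm_state al -> prb a al = 1 -> prb a' al = 1 -> a = a'.
Proof.
move=> pa pa' pal nal a1 a'1; apply: contrapT => naa'.
have [x Tx nx] := effect_neq naa'.
have [E [C [e [nC Te Ex]]]] := state_dilation Tx; have [eps neps] := norm_exists E.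
(* Were [C] this product, [x] would be a multiple of [al], on which [a] and [a'] agree. *)
have neq : C <> insr al eps.
  by move=> EC; apply: nx; rewrite Ex EC effr_insr !prbZr comp1l a1 a'1.
have nD := norm_insr nal neps.
have [e' Te' ne'] := state_neq neq.
have [F [W [g [pW cW Tg Wu Wg]]]] := coherent_split nC nD neq Te' pal nal.
by apply: naa'; exact: (sharp_effect_eq pal nal pW cW Tg ne' Wu Wg).
Qed.

End Theory.

Theorem theorem3 (R : realType) (T : OPTData R)
  (HT : OPT_axioms T) (HS : sharp_with_purification T) (A : Sys T) :
  exists dag : {alpha : V T (Iu T) A | pure alpha /\ norm_state alpha} ->
               {a : V T A (Iu T) | pure a /\ norm_effect a},
    bijective dag /\
    forall alpha, prb (sval (dag alpha)) (sval alpha) = 1.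
Proof.
have norm_of (a : V T A (Iu T)) x : pure a -> norm_state x -> prb a x = 1 -> norm_effect a.
  move=> pa nx ax; have Ta := pure_Tr pa; split=> //; split.
    by move=> y ny; exact: (prb_le1 HT) Ta (norm_Tr ny).
  by move=> eps eps0; exists x; split => //; rewrite ax ltrBlDr ltrDl.
have exd (al : {alpha : V T (Iu T) A | pure alpha /\ norm_state alpha}) :
    exists a : {a : V T A (Iu T) | pure a /\ norm_effect a}, prb (sval a) (sval al) = 1.
  case: al => al [pal nal]; have [a pa a1] := sharp_effect HT HS pal nal.
  by exists (exist _ a (conj pa (norm_of _ _ pa nal a1))).
have exs (a : {a : V T A (Iu T) | pure a /\ norm_effect a}) :
    exists al : {alpha : V T (Iu T) A | pure alpha /\ norm_state alpha},
      prb (sval a) (sval al) = 1.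
  case: a => a [pa na]; have [x nx ax] := norm_effect_attained HT HS na.
  by exists (exist _ x (conj (sharp_pure HT HS pa nx ax) nx)).
have sig_eq (X : Type) (P : X -> Prop) (x y : {z | P z}) : sval x = sval y -> x = y.
  case: x y => [x px] [y py] /= xy; case: y / xy py => py.
  by rewrite (Prop_irrelevance px py).
(* Both maps are chosen as sharp partners; the two uniqueness results make them mutually inverse. *)
have [dag dagP] := choice exd; have [st stP] := choice exs.
exists dag; split => //; exists st.
  move=> al; apply: sig_eq.
  have := stP (dag al); have := dagP al.
  case: (dag al) => a [pa na] /=; case: al => al [pal nal] /=; case: (st _) => x [px nx] /=.
  by move=> a1 ax; exact: (sharp_state_unique HT HS pa nx nal ax a1).
move=> a; apply: sig_eq.
have := stP a; have := dagP (st a).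
case: (st a) => x [px nx] /=; case: a => a [pa na] /=; case: (dag _) => b [pb nb] /=.
by move=> b1 a1; exact: (sharp_effect_unique HT HS pb pa px nx b1 a1).
Qed.
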